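(* (Rosenthal's inequality) Let $(\Omega,\mathscr{H},\widehat{\mathbb E})$ be a sub-linear expectation space, let $X_1,\ldots,X_n\in\mathscr{H}$, and put $S_k=X_1+\cdots+X_k$. Below, $C_p$ denotes a positive constant depending only on $p$. (a) Suppose that $X_k$ is negatively dependent to $(X_{k+1},\ldots,X_n)$ for each $k=1,\ldots,n-1$, and $\widehat{\mathbb E}[X_k]\le0$ for $k=1,\ldots,n$. Then $$\widehat{\mathbb E}\Big[\big|\max_{1\le k\le n}S_k\big|^p\Big]\le 2^{2-p}\sum_{k=1}^n\widehat{\mathbb E}[|X_k|^p]\quad\text{for }1\le p\le2,$$ and $$\widehat{\mathbb E}\Big[\big|\max_{1\le k\le n}S_k\big|^p\Big]\le C_p\,n^{p/2-1}\sum_{k=1}^n\widehat{\mathbb E}[|X_k|^p]\quad\text{for }p\ge2.$$ (b) Suppose that $X_k$ is independent to $(X_{k+1},\ldots,X_n)$ for each $k=1,\ldots,n-1$, and $\widehat{\mathbb E}[X_k]\le0$ for $k=1,\ldots,n$. Then $$\widehat{\mathbb E}\Big[\big|\max_{1\le k\le n}S_k\big|^p\Big]\le C_p\Big\{\sum_{k=1}^n\widehat{\mathbb E}[|X_k|^p]+\Big(\sum_{k=1}^n\widehat{\mathbb E}[|X_k|^2]\Big)^{p/2}\Big\}\quad\text{for }p\ge2.$$ (c) In general, suppose that $X_k$ is negatively dependent to $(X_{k+1},\ldots,X_n)$ for each $k=1,\ldots,n-1$, or that $X_{k+1}$ is negatively dependent to $(X_1,\ldots,X_k)$ for each $k=1,\ldots,n-1$.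 Then for $p\ge2$ $$\widehat{\mathbb E}\Big[\max_{1\le k\le n}|S_k|^p\Big]\le C_p\Big\{\sum_{k=1}^n\widehat{\mathbb E}[|X_k|^p]+\Big(\sum_{k=1}^n\widehat{\mathbb E}[|X_k|^2]\Big)^{p/2}+\Big(\sum_{k=1}^n\big[(\widehat{\mathcal E}[X_k])^-+(\widehat{\mathbb E}[X_k])^+\big]\Big)^p\Big\}.$$
   Context: Let $(\Omega,\mathcal F)$ be a measurable space. $C_{l,Lip}(\mathbb R^n)$ is the linear space of functions $\varphi:\mathbb R^n\to\mathbb R$ such that $|\varphi(x)-\varphi(y)|\le C(1+|x|^m+|y|^m)|x-y|$ for all $x,y\in\mathbb R^n$, for some $C>0$, $m\in\mathbb N$ depending on $\varphi$. $\mathscr H$ is a linear space of real functions on $(\Omega,\mathcal F)$ (called random variables) such that $X_1,\ldots,X_n\in\mathscr H$ implies $\varphi(X_1,\ldots,X_n)\in\mathscr H$ for every $\varphi\in C_{l,Lip}(\mathbb R^n)$. A sub-linear expectation on $\mathscr H$ is a functional $\widehat{\mathbb E}:\mathscr H\to[-\infty,\infty]$ such that for all $X,Y\in\mathscr H$: (a) $X\ge Y$ implies $\widehat{\mathbb E}[X]\ge\widehat{\mathbb E}[Y]$; (b) $\widehat{\mathbb E}[c]=c$ for constants $c$; (c) $\widehat{\mathbb E}[X+Y]\le\widehat{\mathbb E}[X]+\widehat{\mathbb E}[Y]$ whenever the right side is not of the form $+\infty-\infty$ or $-\infty+\infty$; (d) $\widehat{\mathbb E}[\lambda X]=\lambda\widehat{\mathbb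 E}[X]$ for $\lambda\ge0$. The triple $(\Omega,\mathscr H,\widehat{\mathbb E})$ is called a sub-linear expectation space. The conjugate expectation is $\widehat{\mathcal E}[X]:=-\widehat{\mathbb E}[-X]$. Independence (not symmetric): a random vector $\mathbf Y=(Y_1,\ldots,Y_n)$, $Y_i\in\mathscr H$, is independent to $\mathbf X=(X_1,\ldots,X_m)$, $X_i\in\mathscr H$, if for each $\varphi\in C_{l,Lip}(\mathbb R^m\times\mathbb R^n)$ one has $\widehat{\mathbb E}[\varphi(\mathbf X,\mathbf Y)]=\widehat{\mathbb E}\big[\widehat{\mathbb E}[\varphi(\mathbf x,\mathbf Y)]\big|_{\mathbf x=\mathbf X}\big]$ whenever $\overline\varphi(\mathbf x):=\widehat{\mathbb E}[|\varphi(\mathbf x,\mathbf Y)|]<\infty$ for all $\mathbf x$ and $\widehat{\mathbb E}[|\overline\varphi(\mathbf X)|]<\infty$. Negative dependence: $\mathbf Y=(Y_1,\ldots,Y_n)$, $Y_i\in\mathscr H$, is negatively dependent to $\mathbf X=(X_1,\ldots,X_m)$, $X_i\in\mathscr H$, if for each pair $\varphi_1\in C_{l,Lip}(\mathbb R^m)$, $\varphi_2\in C_{l,Lip}(\mathbb R^n)$ one has $\widehat{\mathbb E}[\varphi_1(\mathbf X)\varphi_2(\mathbf Y)]\le\widehat{\mathbb E}[\varphi_1(\mathbf X)]\,\widehat{\mathbb E}[\varphi_2(\mathbf Y)]$ whenever $\varphi_1(\mathbf X)\ge0$, $\widehat{\mathbb E}[\varphi_2(\mathbf Y)]\ge0$,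 $\widehat{\mathbb E}[|\varphi_1(\mathbf X)\varphi_2(\mathbf Y)|]<\infty$, $\widehat{\mathbb E}[|\varphi_1(\mathbf X)|]<\infty$, $\widehat{\mathbb E}[|\varphi_2(\mathbf Y)|]<\infty$, and either $\varphi_1,\varphi_2$ are both coordinatewise nondecreasing or both coordinatewise non-increasing. $x^+=\max(x,0)$ and $x^-=\max(-x,0)$. *)

(* Defs.v *)
From HB Require Import structures.
From mathcomp Require Import all_boot all_order all_algebra.
From mathcomp Require Import all_classical all_reals all_analysis.

Set Implicit Arguments.
Unset Strict Implicit.
Unset Printing Implicit Defensive.

Import Order.TTheory GRing.Theory Num.Theory.
Import numFieldNormedType.Exports.

Local Open Scope classical_set_scope.
Local Open Scope ring_scope.

(* The library norm on ['rV[R]_n] is the sup norm. *)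
Definition eucl_norm (R : realType) (n : nat) (x : 'rV[R]_n) : R :=
  Num.sqrt (\sum_(i < n) x 0 i ^+ 2).

Definition C_lLip (R : realType) (n : nat) (phi : 'rV[R]_n -> R) : Prop :=
  exists (C : R) (m : nat), 0 < C /\
    forall x y : 'rV[R]_n,
      `|phi x - phi y| <=
        C * (1 + eucl_norm x ^+ m + eucl_norm y ^+ m) * eucl_norm (x - y).

Definition coord_nondecreasing (R : realType) (n : nat)
    (phi : 'rV[R]_n -> R) : Prop :=
  forall (i : 'I_n) (x y : 'rV[R]_n),
    (forall j, j != i -> x 0 j = y 0 j) -> x 0 i <= y 0 i -> phi x <= phi y.

Definition coord_nonincreasing (R : realType) (n : nat)
    (phi : 'rV[R]_n -> R) : Prop :=
  forall (i : 'I_n) (x y : 'rV[R]_n),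
    (forall j, j != i -> x 0 j = y 0 j) -> x 0 i <= y 0 i -> phi y <= phi x.

Definition rvec (R : realType) (T : Type) (n : nat) (X : 'I_n -> T -> R)
    (w : T) : 'rV[R]_n :=
  \row_(i < n) X i w.

Record random_variable_space (R : realType) (T : Type) (H : set (T -> R))
    : Prop := RandomVariableSpace {
  rvs0 : H (fun=> 0) ;
  rvsD : forall X Y, H X -> H Y -> H (fun w => X w + Y w) ;
  rvsZ : forall (a : R) X, H X -> H (fun w => a * X w) ;
  rvs_comp : forall (n : nat) (X : 'I_n -> T -> R) (phi : 'rV[R]_n -> R),
    (forall i, H (X i)) -> C_lLip phi -> H (fun w => phi (rvec X w))
}.

(* [E] is a total function, but only its values on [H] are constrained and only
   those are meaningful: [E] represents a functional [H -> [-oo, +oo]].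
   [x +? y] excludes the forms [+oo - oo] and [-oo + oo]. *)
Record sublinear_expectation (R : realType) (T : Type) (H : set (T -> R))
    (E : (T -> R) -> \bar R) : Prop := SublinearExpectation {
  sle_mono : forall X Y, H X -> H Y ->
    (forall w, Y w <= X w) -> (E Y <= E X)%E ;
  sle_cst : forall c : R, E (fun=> c) = c%:E ;
  sle_subadd : forall X Y, H X -> H Y ->
    (E X +? E Y)%E -> (E (fun w => X w + Y w)%R <= E X + E Y)%E ;
  sle_poshom : forall (a : R) X, 0 <= a -> H X ->
    E (fun w => a * X w) = (a%:E * E X)%E
}.

(* The random variables are not required to be measurable. *)
Record sublinear_space (R : realType) (d : measure_display)
    (T : measurableType d) (H : set (T -> R)) (E : (T -> R) -> \bar R)
    : Prop := SublinearSpace {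
  sls_rv : random_variable_space H ;
  sls_expectation : sublinear_expectation H E
}.

Definition conj_expectation (R : realType) (T : Type)
    (E : (T -> R) -> \bar R) (X : T -> R) : \bar R :=
  (- E (fun w => - X w)%R)%E.

(* [indep_to H E Y X]: the vector [Y] is independent to the vector [X].
   When the function [phibar] is finite, [fine] merely views it (and
   [x |-> E[phi(x, Y)]]) as real-valued. As these functions of [x] need not be
   in [C_lLip], their composites with [X] need not be in the domain [H] of [E];
   the identity is required exactly when all expectations in it are defined. *)
Definition indep_to (R : realType) (T : Type) (H : set (T -> R))
    (E : (T -> R) -> \bar R) (n m : nat)
    (Y : 'I_n -> T -> R) (X : 'I_m -> T -> R) : Prop :=
  forall phi : 'rV[R]_(m + n) -> R, C_lLip phi ->
    let phibar (x : 'rV[R]_m) := E (fun w => `|phi (row_mx x (rvec Y w))|) in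
    let phiY (x : 'rV[R]_m) := E (fun w => phi (row_mx x (rvec Y w))) in
    let abs_phibar_X (w : T) := `|fine (phibar (rvec X w))| in
    let phiY_X (w : T) := fine (phiY (rvec X w)) in
    (forall x, (phibar x < +oo)%E) ->
    H abs_phibar_X -> (E abs_phibar_X < +oo)%E ->
    H phiY_X ->
    E (fun w => phi (row_mx (rvec X w) (rvec Y w))) = E phiY_X.

(* [neg_dep_to E Y X]: the vector [Y] is negatively dependent to [X]. *)
Definition neg_dep_to (R : realType) (T : Type)
    (E : (T -> R) -> \bar R) (n m : nat)
    (Y : 'I_n -> T -> R) (X : 'I_m -> T -> R) : Prop :=
  forall (phi1 : 'rV[R]_m -> R) (phi2 : 'rV[R]_n -> R),
    C_lLip phi1 -> C_lLip phi2 ->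
    (forall w, 0 <= phi1 (rvec X w)) ->
    (0 <= E (fun w => phi2 (rvec Y w)))%E ->
    (E (fun w => `|phi1 (rvec X w) * phi2 (rvec Y w)|%R) < +oo)%E ->
    (E (fun w => `|phi1 (rvec X w)|%R) < +oo)%E ->
    (E (fun w => `|phi2 (rvec Y w)|%R) < +oo)%E ->
    (coord_nondecreasing phi1 /\ coord_nondecreasing phi2) \/
    (coord_nonincreasing phi1 /\ coord_nonincreasing phi2) ->
    (E (fun w => phi1 (rvec X w) * phi2 (rvec Y w))%R <=
     E (fun w => phi1 (rvec X w)) * E (fun w => phi2 (rvec Y w)))%E.

(* Sequences are indexed from 1: X_1, ..., X_n are [X 1], ..., [X n], and the
   value [X 0] plays no role. *)

Definition single (R : realType) (T : Type) (X : nat -> T -> R) (k : nat)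
    : 'I_1 -> T -> R :=
  fun=> X k.
Arguments single {R T} X k _ _.

(* (X_1, ..., X_k) *)
Definition initial (R : realType) (T : Type) (X : nat -> T -> R) (k : nat)
    : 'I_k -> T -> R :=
  fun i => X i.+1.
Arguments initial {R T} X k _ _.

(* (X_{k+1}, ..., X_n) *)
Definition final (R : realType) (T : Type) (X : nat -> T -> R) (n k : nat)
    : 'I_(n - k) -> T -> R :=
  fun i => X (k.+1 + i)%N.
Arguments final {R T} X n k _ _.

Definition psum (R : realType) (T : Type) (X : nat -> T -> R) (k : nat)
    (w : T) : R :=
  \sum_(1 <= i < k.+1) X i w.

(* For [0 < n] the seed of the iterated maxima below is one of their terms. *)
Definition max_psum (R : realType) (T : Type) (X : nat -> T -> R) (n : nat)
    (w : T) : R :=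
  \big[Num.max/psum X 1 w]_(1 <= k < n.+1) psum X k w.

Definition max_abs_psum (R : realType) (T : Type) (X : nat -> T -> R) (n : nat)
    (w : T) : R :=
  \big[Num.max/`|psum X 1 w|]_(1 <= k < n.+1) `|psum X k w|.

(* Main.v *)
Require Import Defs.
From HB Require Import structures.
From mathcomp Require Import all_boot all_order all_algebra.
From mathcomp Require Import all_classical all_reals all_analysis.
From mathcomp Require Import ring lra zify.

Set Implicit Arguments.
Unset Strict Implicit.
Unset Printing Implicit Defensive.

Import Order.TTheory GRing.Theory Num.Theory.
Import numFieldNormedType.Exports.

Local Open Scope classical_set_scope.
Local Open Scope ring_scope.

(** Put [V_k = max(0, X_(k+1), X_(k+1) + X_(k+2), ..., X_(k+1) + ... + X_n)].
Then [V_k = max(0, X_(k+1) + V_(k+1))] and [max S_k = X_1 + V_1], so that the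
moments of the maximum are obtained by a recursion from the last variable
backwards, in which [V_(k+1)] is an increasing function of the variables that
follow [X_(k+1)]. One step rests on an expansion

  [|x + t|^p <= t^p + p x t^(p-1) + remainder]   for [t >= 0],

with [x = X_(k+1)] and [t = V_(k+1)]. The linear term has nonpositive expectation
as soon as [E X_(k+1) <= 0]: by negative dependence applied to the centred
variable and the increasing function [t^(p-1)], or by independence. The three
bounds without drift differ in the treatment of the remainder.

- For [1 <= p <= 2] it is [2^(2-p) |x|^p] ([powR_normD_le2]) and the recursion is
  a plain sum. As [t^(p-1)] is not locally Lipschitz at [0], the recursion is run
  for [V_k + eps] with [eps > 0], and [eps] tends to [0] ([moment_bound_le2]).
- For [p >= 2] it is [K (|x|^p + x^2 t^(p-2))] ([powR_normD_ge2]). Under negative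
  dependence the product is split pointwise into [t^p / n] and a multiple of
  [n^(p/2-1) |x|^p]; the factors [1 + 1/n] multiply up to at most
  [exp 1] ([moment_bound_ge2]).
- Under independence [E(x^2 g(t)) = E(x^2) E(g(t))] for [g >= 0], and with [B] the
  sum of the second moments [t^(p-2) <= t^p / B + B^(p/2-1)]. The factors
  [1 + K E(X_k^2) / B] multiply up to at most [exp K], and the terms
  [K E(X_k^2) B^(p/2-1)] add up to [K B^(p/2)] ([indep_moment_bound]).

Without any assumption on the means, the linear terms contribute
[a_k E(V_k^(p-1))] with [a_k] the positive part of [E X_k]. The quadratic terms
cannot be treated one by one, since the square of the negative part of [X_k] is
decreasing in [X_k]. The expansions are therefore added up pointwise, and every
[V_k] is bounded by [2 M], where [M = max |S_k|]: there remains
[(sum X_k^2) (2 M)^(p-2)], at most a small multiple of [M^p] plus a multiple of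
[(sum X_k^2)^(p/2)] ([future_max_moment_drift]). The expectation of the latter is
bounded by splitting each square into those of the positive and negative parts,
which are monotone, and by the recursion once more ([square_function_moment]). As
[M] is at most the larger of [V_0] for the variables and for their opposites, the
small multiples of [E(M^p)] are absorbed into the left-hand side
([max_abs_moment]). When each variable is instead negatively dependent to the
earlier ones, reversing the order of the variables reduces to the first case, at
the cost of a factor 2 on [M] ([max_abs_psum_reversed]).

If one of the moments of order [p] is infinite there is nothing to prove;
otherwise all the variables involved have finite expectations, and the whole
argument takes place in the real numbers. *)

(** * Inequalities between powers *)

Section PowerInequalities.
Context {R : realType}.
Implicit Types a b p q r s t u x y : R.

Lemma powR_ge1 x r : 1 <= x -> 0 <= r -> 1 <= x `^ r.
Proof.
move=> x1 r0; rewrite -[leLHS](powRr0 x); exact: ler_powR.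
Qed.

Lemma ler_powR_base r x y : 0 <= r -> 0 <= x -> x <= y -> x `^ r <= y `^ r.
Proof.
move=> r0 x0 xy; apply: ge0_ler_powR; rewrite ?nnegrE//.
exact: le_trans xy.
Qed.

Lemma powRBM x p : 0 <= x -> 0 < p -> x `^ (p - 1) * x = x `^ p.
Proof. by move=> x0 p0; rewrite mulrC mulr_powRB1. Qed.

Lemma powRB2M x p : 0 <= x -> 1 < p -> x `^ (p - 2) * x ^+ 2 = x `^ p.
Proof.
move=> x0 p1; have -> : p - 2 = (p - 1) - 1 by ring.
rewrite expr2 mulrA powRBM//; last by lra.
by rewrite powRBM//; lra.
Qed.

(** Convexity of the power: the graph lies above its tangents. This is Young's
inequality for the conjugate exponents [s] and [s / (s - 1)]. *)
Lemma powR_tangent a b s : 0 <= a -> 0 <= b -> 1 <= s ->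
  a `^ s + s * a `^ (s - 1) * (b - a) <= b `^ s.
Proof.
move=> a0 b0; rewrite le_eqVlt => /predU1P[<-|s1].
  by rewrite subrr powRr0 !powRr1//; lra.
have s0 : 0 < s by lra.
have h : a `^ (s - 1) * b <= (a `^ (s - 1)) `^ (s / (s - 1)) / (s / (s - 1)) + b `^ s / s.
  apply: conjugate_powR => //; first exact: powR_ge0.
  - by apply: divr_gt0; lra.
  - by field; apply/andP; split; lra.
rewrite -powRrM mulrCA divff ?mulr1 in h; last by lra.
have := powRBM a0 s0; have := ler_wpM2l (ltW s0) h.
have -> : s * (a `^ s / (s / (s - 1)) + b `^ s / s) = (s - 1) * a `^ s + b `^ s.
  by field; apply/andP; split; lra.
by nra.
Qed.

(** The preceding inequality for the exponent [r^-1] at the points [a `^ r]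
and [b `^ r]. *)
Lemma powR_tangent_concave a b r : 0 <= a -> 0 < b -> 0 <= r -> r <= 1 ->
  a `^ r <= b `^ r + r * b `^ (r - 1) * (a - b).
Proof.
move=> a0 b0; rewrite le_eqVlt => /predU1P[<- _|r0 r1].
  by rewrite !powRr0; lra.
have rV : 1 <= r^-1 by rewrite invf_ge1.
have := powR_tangent (powR_ge0 b r) (powR_ge0 a r) rV.
rewrite -!powRrM divff ?gt_eqF// !powRr1 ?(ltW b0)//.
have -> : r * (r^-1 - 1) = - (r - 1) by field; lra.
rewrite powRN => h.
have c0 : 0 < b `^ (r - 1) by exact: powR_gt0.
have -> : a `^ r = b `^ r + r * b `^ (r - 1) * (r^-1 / b `^ (r - 1) * (a `^ r - b `^ r)).
  by field; apply/andP; split; lra.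
by rewrite lerD2l ler_wpM2l ?mulr_ge0//; lra.
Qed.

Lemma powR_lipschitz a b s : 0 <= a -> 0 <= b -> 1 <= s ->
  `|a `^ s - b `^ s| <= s * Num.max a b `^ (s - 1) * `|a - b|.
Proof.
wlog ab : a b / b <= a.
  move=> h a0 b0 s1; have /orP[ab|ab] := le_total b a; first exact: h.
  rewrite distrC (distrC a) maxC; exact: h.
move=> a0 b0 s1; rewrite max_l// !ger0_norm ?subr_ge0 ?ler_powR_base//; last by lra.
have := powR_tangent a0 b0 s1; lra.
Qed.

Lemma powRD_le a b s : 0 <= a -> 0 <= b -> 0 <= s ->
  (a + b) `^ s <= 2 `^ s * (a `^ s + b `^ s).
Proof.
wlog ab : a b / b <= a.
  move=> h a0 b0 s1; have /orP[ab|ab] := le_total b a; first exact: h.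
  rewrite addrC (addrC (a `^ s)); exact: h.
move=> a0 b0 s0; apply: (@le_trans _ _ ((2 * a) `^ s)).
  by apply: ler_powR_base => //; lra.
by rewrite powRM// ler_wpM2l ?powR_ge0// lerDl powR_ge0.
Qed.

(** One of the two terms dominates according to whether [u <= c * t `^ q]. *)
Lemma young_split u t c p q : 0 <= u -> 0 <= t -> 0 < c -> 0 < q -> q <= p ->
  u * t `^ (p - q) <= c * t `^ p + c `^ (- ((p - q) / q)) * u `^ (p / q).
Proof.
move=> u0 t0 c0 q0 qp; have [h|/ltW h] := leP u (c * t `^ q).
  apply: ler_wpDr; first by rewrite mulr_ge0 ?powR_ge0.
  apply: le_trans (ler_wpM2r (powR_ge0 _ _) h) _.
  rewrite -mulrA -powRD; first by rewrite addrC subrK.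
  by apply/implyP => /eqP; lra.
apply: ler_wpDl; first by rewrite mulr_ge0 ?powR_ge0// ltW.
have tu : t <= (u / c) `^ (q^-1).
  have -> : t = (t `^ q) `^ (q^-1) by rewrite -powRrM divff ?gt_eqF// powRr1.
  apply: ler_powR_base; rewrite ?powR_ge0 ?invr_ge0 ?(ltW q0)//.
  by rewrite ler_pdivlMr// mulrC.
apply: le_trans (ler_wpM2l u0 (ler_powR_base _ t0 tu)) _; first by lra.
rewrite -powRrM powRM ?invr_ge0 ?(ltW c0)// -(powR_inv1 (ltW c0)) -powRrM.
have -> : -1 * (q^-1 * (p - q)) = - ((p - q) / q) by field; lra.
have -> : u `^ (p / q) = u * u `^ (q^-1 * (p - q)).
  have -> : q^-1 * (p - q) = p / q - 1 by field; lra.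
  by rewrite mulr_powRB1// divr_gt0//; lra.
by rewrite [leLHS]mulrA [leLHS]mulrC.
Qed.


(* On [0, 1] a power of exponent at most 1 exceeds its argument. *)
Let subadd x r : 0 <= x -> 0 <= r -> r <= 1 -> 1 <= x `^ r + (1 - x) `^ r \/ 1 < x.
Proof.
move=> x0 r0 r1; have [x1|] := lerP x 1; [left|by right].
have small z : 0 <= z -> z <= 1 -> z <= z `^ r.
  rewrite le_eqVlt => /predU1P[<- _|z0 z1]; first exact: powR_ge0.
  by apply: ger1_powR; rewrite ?z0.
have := small x x0 x1.
have : 1 - x <= (1 - x) `^ r by apply: small; lra.
lra.
Qed.

Lemma powR1D_subadd x r : 0 <= x -> 0 <= r -> r <= 1 ->
  (1 + x) `^ r <= 1 + x `^ r.
Proof.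
move=> x0 r0 r1; have x10 : 0 < 1 + x by lra.
have := @subadd (x / (1 + x)) r (divr_ge0 x0 (ltW x10)) r0 r1.
have -> : 1 - x / (1 + x) = (1 + x)^-1 by field; lra.
case=> [h|]; last by rewrite ltr_pdivlMr//; lra.
have := ler_wpM2l (powR_ge0 (1 + x) r) h.
rewrite mulr1 mulrDr -!powRM ?invr_ge0 ?divr_ge0 ?(ltW x10)//.
have -> : (1 + x) * (x / (1 + x)) = x by field; lra.
by rewrite divff ?gt_eqF// powR1 [leRHS]addrC.
Qed.

Lemma powR1B_subadd x r : 0 <= x -> x <= 1 -> 0 <= r -> r <= 1 ->
  1 <= x `^ r + (1 - x) `^ r.
Proof. by move=> x0 x1 r0 r1; case: (subadd x0 r0 r1) => //; lra. Qed.

(** The sum of the tangent inequalities at the midpoint of [1] and [x]. *)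
Lemma powR1D_concave x r : 0 <= x -> 0 <= r -> r <= 1 ->
  1 + x `^ r <= 2 `^ (1 - r) * (1 + x) `^ r.
Proof.
move=> x0 r0 r1; have m0 : 0 < (1 + x) / 2 by lra.
have h1 := powR_tangent_concave ler01 m0 r0 r1.
have h2 := powR_tangent_concave x0 m0 r0 r1.
rewrite powR1 in h1.
have -> : 2 `^ (1 - r) * (1 + x) `^ r = 2 * ((1 + x) / 2) `^ r.
  rewrite powRM ?invr_ge0//; last by lra.
  rewrite -powR_inv1// -powRrM powRB ?powRr1//; last first.
    by apply/implyP => _; rewrite pnatr_eq0.
  by rewrite mulN1r powRN; field; rewrite gt_eqF// powR_gt0.
nra.
Qed.

(* With [u = `|x| / t - 1], the inequality of [powR_normD_le2] for [x < - t]
reads [p - 1 <= F p u]. *)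
Let F p u : R := 2 `^ (2 - p) * (1 + u) `^ p - u `^ p - p * u.

Let dF p u : R := p * (2 `^ (2 - p) * (1 + u) `^ (p - 1) - u `^ (p - 1) - 1).

Let F_derive p u : 0 < u -> is_derive u 1 (F p) (dF p u).
Proof.
move=> u0; have u1 : 0 < 1 + u by lra.
have d2 : is_derive u (1:R) (fun x => (1 + x) `^ p) (p * (1 + u) `^ (p - 1)).
  have d := is_derive1_powR p u1.
  apply: is_derive_eq; first exact: (@is_derive1_comp R (fun x => x `^ p) (fun x => 1 + x)).
  by rewrite add0r !mulr1.
have d1 := is_derive1_powR p u0.
have d := is_deriveB (is_deriveB (is_deriveZ (2 `^ (2 - p)) d2) d1)
  (is_deriveZ p (is_derive_id u (1 : R))).
have <- : 2 `^ (2 - p) *: (p * (1 + u) `^ (p - 1)) - p * u `^ (p - 1) - p *: (1 : R)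
    = dF p u by rewrite /dF/= /GRing.scale/=; ring.
exact: d.
Qed.

Let F_ge p u : 1 <= p -> p <= 2 -> 1 <= u -> p - 1 <= F p u.
Proof.
move=> p1 p2 u1.
(* The bound holds at [1] as [p <= 2], and [F p] increases on [1, +oo[. *)
have F1 : F p 1 = 3 - p.
  rewrite /F powR1 -[1 + 1]/(2%:R : R) -powRD ?subrK; last first.
    by rewrite pnatr_eq0 implybT.
  by rewrite -[2]/(2%:R) powR_mulrn//; ring.
have D x : x \in `]1, u[ -> is_derive x 1 (F p) (dF p x).
  by rewrite in_itv/= => /andP[x1 _]; apply: F_derive; lra.
have [|c] := MVT_segment u1 D.
  apply: derivable_within_continuous => x; rewrite in_itv/= => /andP[x1 _].
  have x0 : 0 < x by lra.
  by have [] := F_derive p x0.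
rewrite in_itv/= F1 => /andP[c1 _] eF.
have : 0 <= dF p c * (u - 1).
  rewrite mulr_ge0//; last by lra.
  rewrite mulr_ge0//; first by lra.
  have r0 : 0 <= p - 1 by lra.
  have r1 : p - 1 <= 1 by lra.
  have c0 : 0 <= c by lra.
  have := powR1D_concave c0 r0 r1.
  have -> : 1 - (p - 1) = 2 - p by ring.
  lra.
lra.
Qed.

Let ineq1 p x : 1 <= p -> p <= 2 ->
  `|x + 1| `^ p <= 2 `^ (2 - p) * `|x| `^ p + 1 + p * x.
Proof.
move=> p1 p2; have p0 : 0 < p by lra.
have r0 : 0 <= p - 1 by lra.
have r1 : p - 1 <= 1 by lra.
have two : 1 <= (2 : R) `^ (2 - p) by apply: powR_ge1; lra.
have le2 y : y `^ p <= 2 `^ (2 - p) * y `^ p by rewrite ler_peMl ?powR_ge0.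
have [x0|x0] := lerP 0 x.
  rewrite !ger0_norm//; last by lra.
  apply: le_trans (_ : x `^ p + 1 + p * x <= _); last by rewrite !lerD2r.
  have x10 : 0 <= x + 1 by lra.
  rewrite -(powRBM x10 p0) -(powRBM x0 p0).
  have := powR1D_subadd x0 r0 r1; rewrite (addrC 1 x) => h1.
  have := powR_tangent_concave x10 ltr01 r0 r1.
  by rewrite !powR1; nra.
pose y := - x; have y0 : 0 < y by rewrite /y; lra.
have -> : x = - y by rewrite opprK.
rewrite normrN (gtr0_norm y0) mulrN.
have [y1|y1] := lerP y 1.
  rewrite ger0_norm ?(addrC _ 1) ?subr_ge0//.
  apply: le_trans (_ : y `^ p + 1 - p * y <= _); last by rewrite (addrC 1) !lerD2r.
  have y10 : 0 <= 1 - y by lra.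
  rewrite -(powRBM y10 p0) -(powRBM (ltW y0) p0).
  have h1 := powR1B_subadd (ltW y0) y1 r0 r1.
  have := powR_tangent_concave y10 ltr01 r0 r1.
  by rewrite !powR1; nra.
rewrite addrC distrC gtr0_norm ?subr_gt0//.
have u0 : 0 <= y - 1 by lra.
have yE : y = 1 + (y - 1) by ring.
(* The concavity bound alone suffices up to [y = 2] but not beyond. *)
have [u1|u1] := lerP (y - 1) 1; last first.
  by have := F_ge p1 p2 (ltW u1); rewrite /F -yE; nra.
have h := powR1D_concave u0 r0 r1.
rewrite -yE in h.
have e : 1 - (p - 1) = 2 - p by ring.
rewrite e in h.
have ur : y - 1 <= (y - 1) `^ (p - 1).
  have [->|u00] := eqVneq (y - 1) 0; first exact: powR_ge0.
  by apply: ger1_powR => //; rewrite u1 andbT lt_neqAle eq_sym u00.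
rewrite -(powRBM u0 p0) -(powRBM (ltW y0) p0).
nra.
Qed.

(** A von Bahr-Esseen type inequality. Expanding [(1 + x) `^ p] as
[(1 + x) * (1 + x) `^ (p - 1)], the subadditivity of the power [p - 1] gives it
with the constant [1] as long as [- t <= x]; only for [x < - t] is the factor
[2 `^ (2 - p)] needed. *)
Lemma powR_normD_le2 p x t : 1 <= p -> p <= 2 -> 0 < t ->
  `|x + t| `^ p <= 2 `^ (2 - p) * `|x| `^ p + t `^ p + p * x * t `^ (p - 1).
Proof.
move=> p1 p2 t0; have p0 : 0 < p by lra.
have [z ->] : exists z, x = t * z.
  by exists (x / t); rewrite mulrCA divff ?mulr1// gt_eqF.
have -> : t * z + t = t * (z + 1) by ring.
rewrite !normrM !powRM// gtr0_norm//.
apply: le_trans (ler_wpM2l (powR_ge0 t p) (ineq1 z p1 p2)) _.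
by rewrite -(powRBM (ltW t0) p0) le_eqVlt; apply/orP; left; apply/eqP; ring.
Qed.

Definition taylorK p : R := p * p * 2 `^ p + 1.

(** Taylor's formula of order two at [t]: by convexity the remainder is at most
[p * x * ((x + t) `^ (p - 1) - t `^ (p - 1))], and a second tangent inequality
bounds this difference. *)
Lemma powR_normD_ge2 p x t : 2 <= p -> 0 <= t ->
  `|x + t| `^ p <= t `^ p + p * x * t `^ (p - 1)
     + taylorK p * (`|x| `^ p + x ^+ 2 * t `^ (p - 2)).
Proof.
move=> p2 t0; have p0 : 0 < p by lra.
have pp : 1 <= p by lra.
have r0 : 1 <= p - 1 by lra.
have s0 : 0 <= p - 2 by lra.
have two : 1 <= (2 : R) `^ p by apply: powR_ge1; lra.
have a0 := powR_ge0 `|x| p.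
have b0 : 0 <= x ^+ 2 * t `^ (p - 2) by rewrite mulr_ge0 ?sqr_ge0 ?powR_ge0.
have [xt|xt] := lerP 0 (x + t); last first.
  have tx : t <= `|x| by rewrite ltr0_norm; lra.
  have h1 : `|x + t| `^ p <= `|x| `^ p.
    by apply: ler_powR_base; rewrite ?(ltW p0)// !ltr0_norm; lra.
  have h2 : `|x| * t `^ (p - 1) <= `|x| `^ p.
    rewrite -(powRBM (normr_ge0 x) p0) mulrC ler_wpM2r//.
    by apply: ler_powR_base => //; lra.
  have nx : `|x| = - x by rewrite ltr0_norm; lra.
  have h3 : - (p * x * t `^ (p - 1)) <= p * `|x| `^ p.
    have -> : - (p * x * t `^ (p - 1)) = p * (`|x| * t `^ (p - 1)) by rewrite nx; ring.
    by rewrite ler_wpM2l// ltW.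
  have h4 := powR_ge0 t p.
  have hK : 1 + p <= taylorK p by rewrite /taylorK; nra.
  have := ler_wpM2r (addr_ge0 a0 b0) hK.
  nra.
rewrite ger0_norm//.
have h1 := powR_tangent xt t0 pp.
have h2 := powR_lipschitz xt t0 r0.
have h3 : Num.max (x + t) t `^ (p - 2) <= 2 `^ (p - 2) * (`|x| `^ (p - 2) + t `^ (p - 2)).
  apply: le_trans (powRD_le (normr_ge0 x) t0 s0).
  apply: ler_powR_base => //; first by rewrite le_max t0 orbT.
  by rewrite ge_max lerD2r ler_norm lerDr normr_ge0.
have e1 : p - 1 - 1 = p - 2 by ring.
have e2 : x + t - t = x by ring.
rewrite e1 e2 in h2.
have h4 : p * x * ((x + t) `^ (p - 1) - t `^ (p - 1))
   <= p * (p - 1) * x ^+ 2 * Num.max (x + t) t `^ (p - 2).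
  apply: le_trans (ler_norm _) _; rewrite normrM normrM (gtr0_norm p0).
  have := ler_wpM2l (mulr_ge0 (ltW p0) (normr_ge0 x)) h2.
  by rewrite -(real_normK (num_real x)); nra.
have h5 : x ^+ 2 * `|x| `^ (p - 2) = `|x| `^ p.
  by rewrite -(real_normK (num_real x)) mulrC powRB2M//; lra.
have q0 : 0 <= p * (p - 1) by nra.
have h6 := ler_wpM2l (mulr_ge0 q0 (sqr_ge0 x)) h3.
have h7 : p * (p - 1) * 2 `^ (p - 2) <= taylorK p.
  have : (2 : R) `^ (p - 2) <= 2 `^ p by apply: ler_powR; lra.
  rewrite /taylorK; have := powR_ge0 (2 : R) (p - 2); nra.
have := ler_wpM2r (addr_ge0 a0 b0) h7.
rewrite -h5; nra.
Qed.

End PowerInequalities.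

Section PowerInequalities2.
Context {R : realType}.
Implicit Types p q t x B N : R.

Lemma taylorK_ge1 p : 1 <= taylorK p.
Proof. by rewrite /taylorK; have := powR_ge0 (2 : R) p; nra. Qed.

Lemma taylorK_ge p : 2 <= p -> p <= taylorK p.
Proof.
move=> p2; have : 1 <= (2 : R) `^ p by apply: powR_ge1; lra.
by rewrite /taylorK; nra.
Qed.

Lemma sqr_powR_half x p : (x ^+ 2) `^ (p / 2) = `|x| `^ p.
Proof.
rewrite -(real_normK (num_real x)) -powR_mulrn// -powRrM.
by congr (_ `^ _); field.
Qed.

Lemma invr_powRN B r : 0 <= B -> (B^-1) `^ (- r) = B `^ r.
Proof. by move=> B0; rewrite -powR_inv1// -powRrM mulN1r opprK. Qed.

Lemma powR_le_scaled t B p q : 0 <= t -> 0 < B -> 0 < q -> q <= p ->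
  t `^ (p - q) <= t `^ p / B + B `^ (p / q - 1).
Proof.
move=> t0 B0 q0 qp.
have Bi : 0 < B^-1 by rewrite invr_gt0.
have := young_split ler01 t0 Bi q0 qp.
rewrite mul1r invr_powRN ?(ltW B0)// powR1 mulr1 mulrC.
by have -> : (p - q) / q = p / q - 1 by field; lra.
Qed.

(** The quadratic remainder is split by [young_split] so that the factor of
[t `^ p] exceeds [1] by [N^-1] only: [N] iterations of such a bound cost a
factor [expR 1]. *)
Lemma powR_normD_ge2_scaled p N x t : 2 <= p -> 1 <= N -> 0 <= t ->
  `|x + t| `^ p <= (1 + N^-1) * t `^ p + p * (x * t `^ (p - 1))
     + 2 * taylorK p `^ (p / 2) * N `^ (p / 2 - 1) * `|x| `^ p.
Proof.
move=> p2 N1 t0; have K1 := taylorK_ge1 p; have N0 : 0 < N by lra.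
have c0 : 0 < (taylorK p * N)^-1 by rewrite invr_gt0 mulr_gt0//; lra.
have := young_split (sqr_ge0 x) t0 c0 (ltr0n _ 2) p2.
rewrite sqr_powR_half invr_powRN; last by rewrite mulr_ge0; lra.
have -> : (p - 2) / 2 = p / 2 - 1 by field.
rewrite powRM; [|lra|lra] => h.
have h1 := ler_wpM2l (_ : 0 <= taylorK p) h.
have {}h1 := h1 (le_trans ler01 K1).
have h2 := powR_normD_ge2 x p2 t0.
have h3 : taylorK p * (taylorK p * N)^-1 = N^-1 by field; apply/andP; split; lra.
have h4 : taylorK p * taylorK p `^ (p / 2 - 1) = taylorK p `^ (p / 2).
  by rewrite mulr_powRB1//; lra.
have h5 : taylorK p <= taylorK p `^ (p / 2) by apply: le1r_powR => //; lra.
have h6 : 1 <= N `^ (p / 2 - 1) by apply: powR_ge1 => //; lra.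
have h7 : taylorK p * `|x| `^ p <= taylorK p `^ (p / 2) * N `^ (p / 2 - 1) * `|x| `^ p.
  rewrite ler_wpM2r ?powR_ge0//; nra.
have h3' : taylorK p * ((taylorK p * N)^-1 * t `^ p) = N^-1 * t `^ p by rewrite mulrA h3.
have h4' : taylorK p * (taylorK p `^ (p / 2 - 1) * N `^ (p / 2 - 1) * `|x| `^ p) =
    taylorK p `^ (p / 2) * N `^ (p / 2 - 1) * `|x| `^ p by rewrite !mulrA h4.
rewrite [in leRHS]mulrDr h3' h4' in h1.
lra.
Qed.

(** Here the factor [x ^+ 2] is kept apart from the powers of [t], so that
independence can be applied to each product. *)
Lemma powR_normD_ge2_split p B x t : 2 <= p -> 0 < B -> 0 <= t ->
  `|x + t| `^ p <= (t `^ p + taylorK p * `|x| `^ p) + (p * (x * t `^ (p - 1))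
     + (taylorK p / B * (x ^+ 2 * t `^ p)
        + taylorK p * B `^ (p / 2 - 1) * x ^+ 2)).
Proof.
move=> p2 B0 t0; have K1 := taylorK_ge1 p.
have h := powR_le_scaled t0 B0 (ltr0n _ 2) p2.
have h1 := ler_wpM2l (sqr_ge0 x) h.
have {}h1 := ler_wpM2l (le_trans ler01 K1) h1.
have := powR_normD_ge2 x p2 t0; lra.
Qed.

(** For nonnegative summands there is no second order term. The shift by [B]
makes [t `^ (q - 1)] locally Lipschitz when [q < 2]. *)
Lemma powRD_split q B y t : 1 <= q -> 0 < B -> 0 <= y -> 0 <= t ->
  (y + t) `^ q <= t `^ q + q * 2 `^ q * (y * (t + B) `^ (q - 1) + y `^ q).
Proof.
move=> q1 B0 y0 t0; have yt0 : 0 <= y + t by rewrite addr_ge0.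
have h1 := powR_tangent yt0 t0 q1.
have q10 : 0 <= q - 1 by lra.
have h2 := powRD_le y0 t0 q10.
have h3 : t `^ (q - 1) <= (t + B) `^ (q - 1) by apply: ler_powR_base; lra.
have h4 : (2 : R) `^ (q - 1) <= 2 `^ q by apply: ler_powR; lra.
have h5 : (y + t) `^ (q - 1) <= 2 `^ q * (y `^ (q - 1) + (t + B) `^ (q - 1)).
  apply: le_trans h2 _; apply: ler_pM => //; rewrite ?addr_ge0 ?powR_ge0//.
  by rewrite lerD2l.
have qy : 0 <= q * y by rewrite mulr_ge0//; lra.
have := ler_wpM2l qy h5.
have <- : y `^ (q - 1) * y = y `^ q by rewrite powRBM//; lra.
lra.
Qed.

Lemma powR_shift_le_scaled q B t : 1 <= q -> 0 < B -> 0 <= t ->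
  (t + B) `^ (q - 1) <= 2 `^ q * (t `^ q / B + B `^ (q - 1)).
Proof.
move=> q1 B0 t0; have q0 : 0 < q by lra.
have h1 := powRD_le t0 (ltW B0) (ltW q0).
have h2 : (t + B) `^ (q - 1) * B <= (t + B) `^ q.
  rewrite -[leRHS]powRBM//; last by lra.
  by rewrite ler_wpM2l ?powR_ge0//; lra.
have h3 : B `^ q = B `^ (q - 1) * B by rewrite powRBM// ltW.
rewrite -(ler_pM2r B0); apply: le_trans h2 _; apply: le_trans h1 _.
by rewrite h3 -mulrA ler_wpM2l ?powR_ge0// mulrDl divfK// gt_eqF.
Qed.

End PowerInequalities2.

(** * Locally Lipschitz functions of polynomial growth *)

Section LocallyLipschitz.
Context {R : realType}.

Section EuclideanNorm.
Context {n : nat}.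
Implicit Types x y : 'rV[R]_n.

Lemma eucl_norm_ge0 x : 0 <= eucl_norm x.
Proof. exact: sqrtr_ge0. Qed.

Lemma le_coord_eucl_norm x i : `|x 0 i| <= eucl_norm x.
Proof.
rewrite -sqrtr_sqr; apply: ler_wsqrtr.
by rewrite (bigD1 i)//= lerDl sumr_ge0// => j _; exact: sqr_ge0.
Qed.

Lemma eucl_norm_le_sum x : eucl_norm x <= \sum_i `|x 0 i|.
Proof.
have s0 (s : seq 'I_n) : 0 <= \sum_(i <- s) `|x 0 i| by exact: sumr_ge0.
rewrite -[leRHS]ger0_norm// -sqrtr_sqr; apply: ler_wsqrtr.
elim: (index_enum _) => [|i s ih]; first by rewrite !big_nil expr0n.
rewrite !big_cons sqrrD -[x 0 i ^+ 2]real_normK ?num_real//.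
have := mulr_ge0 (normr_ge0 (x 0 i)) (s0 s); lra.
Qed.

End EuclideanNorm.

Definition weight n (x y : 'rV[R]_n) : R := (1 + eucl_norm x) * (1 + eucl_norm y).

Lemma weight_ge1 n (x y : 'rV[R]_n) : 1 <= weight x y.
Proof.
by rewrite /weight; have := eucl_norm_ge0 x; have := eucl_norm_ge0 y; nra.
Qed.

Lemma weightX_ge0 n (x y : 'rV[R]_n) m : 0 <= weight x y ^+ m.
Proof. by apply: exprn_ge0; apply: le_trans (weight_ge1 x y). Qed.

Lemma leX_weight n (x y : 'rV[R]_n) m1 m2 : (m1 <= m2)%N ->
  weight x y ^+ m1 <= weight x y ^+ m2.
Proof. by move=> ?; apply: ler_weXn2l => //; exact: weight_ge1. Qed.

Lemma le1D_weight n (x y : 'rV[R]_n) :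
  1 + eucl_norm x <= weight x y /\ 1 + eucl_norm y <= weight x y.
Proof.
by rewrite /weight; have := eucl_norm_ge0 x; have := eucl_norm_ge0 y; nra.
Qed.

(** The weight [weight x y ^+ m] defines the same class and, being
multiplicative, is stable under products and compositions. *)
Lemma C_lLipP n (phi : 'rV[R]_n -> R) :
  C_lLip phi <-> exists (C : R) (m : nat), 0 <= C /\
    forall x y, `|phi x - phi y| <= C * weight x y ^+ m * eucl_norm (x - y).
Proof.
split=> [[C [m [C0 h]]]|[C [m [C0 h]]]].
  exists (C * 3), m; split => [|x y]; first by rewrite mulr_ge0// ltW.
  apply: le_trans (h x y) _; rewrite ler_wpM2r ?eucl_norm_ge0// -mulrA ler_wpM2l ?(ltW C0)//.
  have [hx hy] := le1D_weight x y; have w1 := weight_ge1 x y.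
  have := eucl_norm_ge0 x; have := eucl_norm_ge0 y => ny nx.
  have h1 : 1 <= weight x y ^+ m by exact: exprn_ege1.
  have h2 : eucl_norm x ^+ m <= weight x y ^+ m by rewrite lerXn2r ?nnegrE//; lra.
  have h3 : eucl_norm y ^+ m <= weight x y ^+ m by rewrite lerXn2r ?nnegrE//; lra.
  lra.
pose D : R := C * 2 ^+ (m.*2).+1 + 1.
have E0 : 0 <= C * 2 ^+ (m.*2).+1 by rewrite mulr_ge0// exprn_ge0.
exists D, m.*2; split => [|x y]; first by rewrite /D; lra.
apply: le_trans (h x y) _; rewrite ler_wpM2r ?eucl_norm_ge0//.
have pow1 (a : R) : 0 <= a -> (1 + a) ^+ m.*2 <= 2 ^+ m.*2 * (1 + a ^+ m.*2).
  move=> a0; have ai : 0 <= a ^+ m.*2 by exact: exprn_ge0.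
  have [a1|/ltW a1] := lerP a 1.
    apply: le_trans (_ : 2 ^+ m.*2 <= _); last by rewrite ler_peMr ?exprn_ge0//; lra.
    by rewrite lerXn2r ?nnegrE//; lra.
  apply: le_trans (_ : (2 * a) ^+ m.*2 <= _); first by rewrite lerXn2r ?nnegrE//; lra.
  by rewrite exprMn ler_wpM2l ?exprn_ge0//; lra.
have nx := eucl_norm_ge0 x; have ny := eucl_norm_ge0 y.
have hx := pow1 _ nx; have hy := pow1 _ ny.
set a := eucl_norm x ^+ m.*2 in hx *; set b := eucl_norm y ^+ m.*2 in hy *.
have a0 : 0 <= a by exact: exprn_ge0.
have b0 : 0 <= b by exact: exprn_ge0.
have hw : weight x y ^+ m <= 2 ^+ m.*2 * (1 + a) + 2 ^+ m.*2 * (1 + b).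
  apply: le_trans (lerD hx hy).
  rewrite /weight exprMn -!addnn !exprD.
  set u := (1 + _) ^+ m; set v := (1 + _) ^+ m.
  have : 0 <= u by apply: exprn_ge0; lra.
  have : 0 <= v by apply: exprn_ge0; lra.
  by have := sqr_ge0 (u - v); nra.
have := ler_wpM2l C0 hw.
have t0 : 0 <= C * 2 ^+ m.*2 by rewrite mulr_ge0// exprn_ge0.
rewrite /D exprS; set q := 2 ^+ m.*2 in t0 *; nra.
Qed.

Lemma C_lLip_growth n (phi : 'rV[R]_n -> R) : C_lLip phi ->
  exists (C : R) (m : nat), 0 <= C /\ forall x, `|phi x| <= C * (1 + eucl_norm x) ^+ m.
Proof.
move=> /C_lLipP[C [m [C0 h]]]; exists (`|phi 0| + C), m.+1; split => [|x].
  by rewrite addr_ge0.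
have nx := eucl_norm_ge0 x.
have := h x 0; rewrite subr0 /weight.
have -> : eucl_norm (0 : 'rV[R]_n) = 0.
  by rewrite /eucl_norm big1 ?sqrtr0// => i _; rewrite mxE expr0n.
rewrite addr0 mulr1 => hx.
have t1 : 1 <= (1 + eucl_norm x) ^+ m by apply: exprn_ege1; lra.
have := normr_ge0 (phi 0).
have : `|phi x| <= `|phi 0| + `|phi x - phi 0|.
  by rewrite -[leLHS]/(`|phi x|) -{1}(subrK (phi 0) (phi x)) addrC ler_normD.
rewrite exprS; set t := (1 + _) ^+ m in hx t1 *; set e := eucl_norm x in nx hx *.
set A := `|phi 0|; set Bx := `|phi x|; set D := `|phi x - phi 0| in hx *.
move=> h1 A0.
have : C * t * e <= C * t * (1 + e) by rewrite ler_wpM2l ?mulr_ge0//; lra.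
have : A <= A * (t * (1 + e)) by rewrite ler_peMr//; nra.
lra.
Qed.

Lemma C_lLip_growth_weight n (phi : 'rV[R]_n -> R) : C_lLip phi ->
  exists (C : R) (m : nat), 0 <= C /\
    forall x y, `|phi x| <= C * weight x y ^+ m /\ `|phi y| <= C * weight x y ^+ m.
Proof.
move=> /C_lLip_growth[C [m [C0 h]]]; exists C, m; split => // x y.
have [hx hy] := le1D_weight x y.
have := eucl_norm_ge0 x; have := eucl_norm_ge0 y => ny nx.
by split; apply: le_trans (h _) _; rewrite ler_wpM2l// lerXn2r ?nnegrE//; lra.
Qed.

Lemma C_lLip_cst n (c : R) : C_lLip (fun _ : 'rV[R]_n => c).
Proof.
apply/C_lLipP; exists 0, 0%N; split => // x y.
by rewrite subrr normr0 !mul0r.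
Qed.

Lemma C_lLip_coord n (i : 'I_n) : C_lLip (fun x : 'rV[R]_n => x 0 i).
Proof.
apply/C_lLipP; exists 1, 0%N; split => // x y.
by rewrite expr0 !mul1r; have := le_coord_eucl_norm (x - y) i; rewrite !mxE.
Qed.

Lemma C_lLipD n (phi psi : 'rV[R]_n -> R) : C_lLip phi -> C_lLip psi ->
  C_lLip (fun x => phi x + psi x).
Proof.
move=> /C_lLipP[C [m [C0 hC]]] /C_lLipP[D [k [D0 hD]]].
apply/C_lLipP; exists (C + D), (m + k)%N; split => [|x y]; first exact: addr_ge0.
have -> : phi x + psi x - (phi y + psi y) = (phi x - phi y) + (psi x - psi y) by ring.
apply: le_trans (ler_normD _ _) _.
apply: le_trans (lerD (hC x y) (hD x y)) _.
rewrite !mulrDl; apply: lerD; rewrite ler_wpM2r ?eucl_norm_ge0// ler_wpM2l//.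
  by rewrite leX_weight// leq_addr.
by rewrite leX_weight// leq_addl.
Qed.

Lemma C_lLipM n (phi psi : 'rV[R]_n -> R) : C_lLip phi -> C_lLip psi ->
  C_lLip (fun x => phi x * psi x).
Proof.
move=> fphi fpsi.
have [A [a [A0 hA]]] := C_lLip_growth_weight fphi.
have [B [b [B0 hB]]] := C_lLip_growth_weight fpsi.
move: fphi fpsi => /C_lLipP[C [m [C0 hC]]] /C_lLipP[D [k [D0 hD]]].
apply/C_lLipP; exists (A * D + C * B), (a + k + (m + b))%N.
split => [|x y]; first by rewrite addr_ge0// mulr_ge0.
have -> : phi x * psi x - phi y * psi y =
  phi x * (psi x - psi y) + (phi x - phi y) * psi y by ring.
apply: le_trans (ler_normD _ _) _; rewrite !normrM.
have [hA1 _] := hA x y; have [_ hB2] := hB x y.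
apply: le_trans (lerD (ler_pM _ _ hA1 (hD x y)) (ler_pM _ _ (hC x y) hB2)) _ => //.
have e0 := eucl_norm_ge0 (x - y).
rewrite !mulrDl; apply: lerD.
  have -> : A * weight x y ^+ a * (D * weight x y ^+ k * eucl_norm (x - y)) =
    A * D * weight x y ^+ (a + k) * eucl_norm (x - y) by rewrite exprD; ring.
  by rewrite ler_wpM2r// ler_wpM2l ?mulr_ge0// leX_weight// leq_addr.
have -> : C * weight x y ^+ m * eucl_norm (x - y) * (B * weight x y ^+ b) =
  C * B * weight x y ^+ (m + b) * eucl_norm (x - y) by rewrite exprD; ring.
by rewrite ler_wpM2r// ler_wpM2l ?mulr_ge0// leX_weight// leq_addl.
Qed.

(** Composition is the one closure property from which those under negation,
reordering, restriction to a subvector and scalar functions follow. *)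
Lemma C_lLip_comp n k (phi : 'rV[R]_k -> R) (c : 'I_k -> 'rV[R]_n -> R) :
  C_lLip phi -> (forall i, C_lLip (c i)) ->
  C_lLip (fun x => phi (\row_i c i x)).
Proof.
move=> /C_lLipP[C [m [C0 hC]]] hc.
have /choice[gr grP] : forall i, exists Am : R * nat, 0 <= Am.1 /\
    forall x, `|c i x| <= Am.1 * (1 + eucl_norm x) ^+ Am.2.
  by move=> i; have [A [a ?]] := C_lLip_growth (hc i); exists (A, a).
have /choice[li liP] : forall i, exists Am : R * nat, 0 <= Am.1 /\
    forall x y, `|c i x - c i y| <= Am.1 * weight x y ^+ Am.2 * eucl_norm (x - y).
  by move=> i; have /C_lLipP[A [a ?]] := hc i; exists (A, a).
pose A : R := 1 + \sum_i (gr i).1; pose a := \sum_i (gr i).2.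
pose B : R := \sum_i (li i).1; pose b := \sum_i (li i).2.
have sum1 : 0 <= \sum_i (gr i).1 by apply: sumr_ge0 => i _; have [] := grP i.
have A0 : 0 <= A by rewrite /A; lra.
have B0 : 0 <= B by apply: sumr_ge0 => i _; have [] := liP i.
have growth x : 1 + eucl_norm (\row_i c i x) <= A * (1 + eucl_norm x) ^+ a.
  have nx : 1 <= 1 + eucl_norm x by have := eucl_norm_ge0 x; lra.
  have nxa : 1 <= (1 + eucl_norm x) ^+ a by exact: exprn_ege1.
  rewrite /A mulrDl mul1r; apply: lerD => //.
  apply: le_trans (eucl_norm_le_sum _) _; rewrite mulr_suml.
  apply: ler_sum => i _; rewrite mxE; have [g0 g] := grP i.
  apply: le_trans (g x) _; rewrite ler_wpM2l//; apply: ler_weXn2l => //.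
  by rewrite /a (bigD1 i)//= leq_addr.
have lip x y : eucl_norm (\row_i c i x - \row_i c i y) <=
    B * weight x y ^+ b * eucl_norm (x - y).
  apply: le_trans (eucl_norm_le_sum _) _; rewrite /B !mulr_suml.
  apply: ler_sum => i _; rewrite !mxE; have [l0 l] := liP i.
  apply: le_trans (l x y) _; rewrite ler_wpM2r ?eucl_norm_ge0// ler_wpM2l//.
  by rewrite leX_weight// /b (bigD1 i)//= leq_addr.
apply/C_lLipP; exists (C * (A * A) ^+ m * B), (a * m + b)%N; split => [|x y].
  by rewrite !mulr_ge0// exprn_ge0// mulr_ge0.
apply: le_trans (hC _ _) _.
have hw : weight (\row_i c i x) (\row_i c i y) ^+ m <=
    (A * A) ^+ m * weight x y ^+ (a * m).
  rewrite exprM -exprMn; apply: lerXn2r; rewrite ?nnegrE.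
  - by apply: le_trans (weight_ge1 _ _).
  - by rewrite !mulr_ge0// weightX_ge0.
  rewrite /weight [X in _ <= _ * X]exprMn.
  have -> : A * A * ((1 + eucl_norm x) ^+ a * (1 + eucl_norm y) ^+ a) =
    (A * (1 + eucl_norm x) ^+ a) * (A * (1 + eucl_norm y) ^+ a) by ring.
  by apply: ler_pM => //; rewrite addr_ge0// eucl_norm_ge0.
apply: le_trans (ler_pM _ (eucl_norm_ge0 _) (ler_wpM2l C0 hw) (lip x y)) _.
  by rewrite mulr_ge0// weightX_ge0.
by rewrite exprD le_eqVlt; apply/orP; left; apply/eqP; ring.
Qed.

Definition lLip1 (f : R -> R) := C_lLip (fun x : 'rV[R]_1 => f (x 0 0)).

Lemma C_lLip_comp1 n (f : R -> R) (phi : 'rV[R]_n -> R) :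
  lLip1 f -> C_lLip phi -> C_lLip (fun x => f (phi x)).
Proof.
move=> hf hphi; have := C_lLip_comp hf (fun _ : 'I_1 => hphi).
by under eq_fun do rewrite mxE.
Qed.

Lemma lLip1P (f : R -> R) (C : R) (m : nat) : 0 <= C ->
  (forall x y, `|f x - f y| <= C * ((1 + `|x|) * (1 + `|y|)) ^+ m * `|x - y|) ->
  lLip1 f.
Proof.
move=> C0 h; apply/C_lLipP; exists C, m; split => // x y.
have e (z : 'rV[R]_1) : eucl_norm z = `|z 0 0|.
  by rewrite /eucl_norm big_ord1 sqrtr_sqr.
by rewrite /weight !e !mxE.
Qed.

Lemma lLip1_lip (f : R -> R) : (forall x y, `|f x - f y| <= `|x - y|) -> lLip1 f.
Proof. by move=> h; apply: (@lLip1P f 1 0) => // x y; rewrite expr0 !mul1r. Qed.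

Lemma lLip1_id : lLip1 id.
Proof. exact: lLip1_lip. Qed.

Lemma lLip1_norm : lLip1 (fun x => `|x|).
Proof. by apply: lLip1_lip => x y; exact: ler_dist_dist. Qed.

Lemma lLip1_maxr0 : lLip1 (fun x => Num.max 0 x).
Proof.
apply: lLip1_lip => x y.
have h1 : x - y <= `|x - y| by exact: ler_norm.
have h2 : y - x <= `|x - y| by rewrite distrC ler_norm.
rewrite ler_norml; apply/andP.
by case: (lerP 0 x) => ?; case: (lerP 0 y) => ?; split; lra.
Qed.

(** Away from the origin every power is locally Lipschitz, hence the shift. *)
Lemma lLip1_powR (e r : R) : 0 <= e -> 0 <= r -> 0 < e \/ 1 <= r ->
  lLip1 (fun x => (`|x| + e) `^ r).
Proof.
move=> e0 r0 her; have [r1|/ltW r1] := lerP 1 r.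
  have [m rm] : exists m, r <= m%:R by exists (Num.bound r); exact/ltW/archi_boundP.
  apply: (@lLip1P _ (r * (1 + e) ^+ m) m) => [|x y].
    by rewrite mulr_ge0// exprn_ge0//; lra.
  have nx : 0 <= `|x| + e by rewrite addr_ge0.
  have ny : 0 <= `|y| + e by rewrite addr_ge0.
  apply: le_trans (powR_lipschitz nx ny r1) _.
  have -> : `|x| + e - (`|y| + e) = `|x| - `|y| by ring.
  apply: ler_pM => //; [by rewrite mulr_ge0// powR_ge0| |exact: ler_dist_dist].
  rewrite -mulrA ler_wpM2l// -exprMn.
  have := normr_ge0 x; have := normr_ge0 y => y0 x0.
  set v := (1 + `|x|) * _; have vx : 1 + `|x| <= v by rewrite /v; nra.
  have vy : 1 + `|y| <= v by rewrite /v; nra.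
  set W := (1 + e) * _; have W1 : v + e <= W by rewrite /W; nra.
  apply: le_trans (_ : W `^ (r - 1) <= _).
    apply: ler_powR_base; [lra|by rewrite le_max nx|].
    by rewrite ge_max; apply/andP; split; lra.
  apply: le_trans (_ : W `^ m%:R <= _); first by apply: ler_powR => //; lra.
  by rewrite powR_mulrn//; lra.
have [{}e0|] := her; last first.
  move=> r1'; have -> : r = 1 by lra.
  by apply: lLip1_lip => x y; rewrite !powRr1 ?addr_ge0// opprD addrACA subrr addr0;
    exact: ler_dist_dist.
apply: (@lLip1P _ (r * e `^ (r - 1)) 0) => [|x y]; first by rewrite mulr_ge0// powR_ge0.
rewrite expr0 mulr1; apply: le_trans (ler_wpM2l _ (ler_dist_dist x y)); last first.
  by rewrite mulr_ge0// powR_ge0.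
have wl (a b : R) : 0 <= b -> b <= a ->
   (a + e) `^ r - (b + e) `^ r <= r * e `^ (r - 1) * (a - b).
  move=> b0 ba; have be : 0 < b + e by lra.
  have ae : 0 <= a + e by lra.
  have := powR_tangent_concave ae be r0 r1.
  have h : (b + e) `^ (r - 1) <= e `^ (r - 1).
    have -> : r - 1 = - (1 - r) by ring.
    rewrite !powRN lef_pV2 ?posrE ?powR_gt0//.
    by apply: ler_powR_base; lra.
  have : r * (b + e) `^ (r - 1) * (a - b) <= r * e `^ (r - 1) * (a - b).
    by rewrite ler_wpM2r ?ler_wpM2l//; lra.
  have -> : a + e - (b + e) = a - b by ring.
  lra.
have [xy|/ltW xy] := lerP `|x| `|y|.
  rewrite [leLHS]distrC ger0_norm ?subr_ge0//; first exact: wl.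
  by apply: ler_powR_base; rewrite ?lerD2r// addr_ge0// ltW.
rewrite ger0_norm ?subr_ge0//; first exact: wl.
by apply: ler_powR_base; rewrite ?lerD2r// addr_ge0// ltW.
Qed.

End LocallyLipschitz.

(** * Backward recursions *)

Section Recursions.
Context {R : realType}.
Implicit Types (d v g b c : nat -> R).

Lemma backward_gronwall n d v g b : (0 < n)%N ->
  (forall k, (k < n)%N -> 0 <= g k) -> (forall k, (k < n)%N -> 0 <= b k) ->
  (forall k, (k < n)%N -> d k <= (1 + g k) * v k.+1 + b k) ->
  (forall k, (0 < k < n)%N -> v k <= d k) -> 0 <= v n ->
  d 0 <= expR (\sum_(0 <= k < n) g k) * (v n + \sum_(0 <= k < n) b k).
Proof.
case: n => // n _; elim: n d v g b => [|n ih] d v g b g0 b0 hd hv vn.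
  rewrite !big_nat1; apply: le_trans (hd 0 isT) _.
  have := expR_ge1Dx (g 0); have := g0 0 isT; have := b0 0 isT.
  by have := expR_gt0 (g 0); nra.
have := @ih (d \o S) (v \o S) (g \o S) (b \o S) (fun k => g0 k.+1)
  (fun k => b0 k.+1) (fun k => hd k.+1) _ vn; rewrite /comp => {}ih.
rewrite big_nat_recl// [X in _ <= _ * (_ + X)]big_nat_recl// expRD.
have h1 : d 1 <= expR (\sum_(0 <= i < n.+1) g i.+1) * (v n.+2 + \sum_(0 <= i < n.+1) b i.+1).
  by apply: ih => k /andP[k0 kn]; apply: hv.
have h2 := hd 0 isT; have h3 := hv 1 isT.
have h4 := expR_ge1Dx (g 0); have h5 := g0 0 isT; have h6 := b0 0 isT.
have G0 : 0 <= \sum_(0 <= i < n.+1) g i.+1.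
  by rewrite big_nat sumr_ge0// => k kn; exact: g0.
have e1 : 1 <= expR (\sum_(0 <= i < n.+1) g i.+1) by rewrite -expR0 ler_expR.
have B0 : 0 <= \sum_(0 <= i < n.+1) b i.+1.
  by rewrite big_nat sumr_ge0// => k kn; exact: b0.
set e := expR _ in h1 e1 *; set e' := expR (g 0) in h4 *.
set s := \sum_(0 <= i < n.+1) b i.+1 in h1 B0 *.
have h7 : (1 + g 0) * v 1 <= e' * (e * (v n.+2 + s)).
  apply: le_trans (_ : (1 + g 0) * (e * (v n.+2 + s)) <= _).
    by rewrite ler_wpM2l; lra.
  by rewrite ler_wpM2r// mulr_ge0; lra.
have h8 : b 0 <= e' * e * b 0 by rewrite ler_peMl//; nra.
have -> : e' * e * (v n.+2 + (b 0 + s)) = e' * (e * (v n.+2 + s)) + e' * e * b 0 by ring.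
lra.
Qed.

(** The recursion is available for every scale [B]. Taking for [B] the sum of
the [b k] bounds the product of the factors [1 + K * b k / B] by [expR K], and
turns the sum of the [b k * B `^ (q - 1)] into the power [q] of that sum. *)
Lemma backward_gronwall_scaled n d v b c (K q : R) : (0 < n)%N -> 1 <= q -> 0 <= K ->
  (forall k, (k < n)%N -> 0 <= b k) -> (forall k, (k < n)%N -> 0 <= c k) ->
  (forall (B : R) k, 0 < B -> (k < n)%N ->
     d k <= (1 + K * b k / B) * v k.+1 + K * c k + K * b k * B `^ (q - 1)) ->
  (forall k, (0 < k < n)%N -> v k <= d k) -> v n = 0 ->
  d 0 <= expR K * K * (\sum_(0 <= k < n) c k + (\sum_(0 <= k < n) b k) `^ q).
Proof.
move=> n0 q1 K0 b0 c0 hd hv vn; set S := \sum_(0 <= k < n) b k.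
have S0 : 0 <= S by rewrite /S big_nat sumr_ge0// => k /andP[_]; exact: b0.
(* If the sum vanishes any positive scale will do. *)
have [B [B0 SB SBq]] : exists B, [/\ 0 < B, S / B <= 1 & S * B `^ (q - 1) = S `^ q].
  have [S00|Sn0] := eqVneq S 0.
    have q0 : q != 0 by lra.
    by exists 1; rewrite S00 !mul0r powR0.
  have Sp : 0 < S by rewrite lt_neqAle eq_sym Sn0.
  by exists S; rewrite divff// mulr_powRB1//; lra.
have bc0 k : (k < n)%N -> 0 <= K * c k + K * b k * B `^ (q - 1).
  by move=> kn; rewrite addr_ge0// !mulr_ge0 ?powR_ge0// ?b0 ?c0.
have := @backward_gronwall n d v (fun k => K * b k / B)
  (fun k => K * c k + K * b k * B `^ (q - 1)) n0 _ bc0 _ hv _.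
have -> : \sum_(0 <= k < n) (K * b k / B) = K * (S / B).
  rewrite /S mulrA mulr_sumr mulr_suml; exact: eq_bigr.
rewrite vn add0r big_split/= -!mulr_sumr -mulr_suml -mulr_sumr -/S -mulrA SBq.
move=> h; apply: le_trans (h _ _ _) _.
- by move=> k kn; rewrite divr_ge0 ?mulr_ge0 ?b0// ltW.
- by move=> k kn; rewrite addrA; exact: hd.
- by [].
have C0 : 0 <= K * (\sum_(0 <= k < n) c k + S `^ q).
  by rewrite mulr_ge0// addr_ge0 ?powR_ge0// big_nat sumr_ge0// => k /andP[_]; exact: c0.
have he : expR (K * (S / B)) <= expR K by rewrite ler_expR ler_piMr.
have := ler_wpM2r C0 he; lra.
Qed.

Lemma down_ind n (P : nat -> Prop) : P n ->
  (forall k, (k < n)%N -> P k.+1 -> P k) -> forall k, (k <= n)%N -> P k.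
Proof.
move=> Pn IH k kn; rewrite -(subKn kn).
elim: (n - k)%N (leq_subr k n) => [|j ih] jn; first by rewrite subn0.
apply: IH; first by lia.
by rewrite subnSK//; apply: ih; exact: ltnW.
Qed.

End Recursions.

(** * Real-valued calculus of sublinear expectations *)

Section SublinearCalculus.
Context {R : realType} {T : Type} {H : set (T -> R)} {E : (T -> R) -> \bar R}.
Hypothesis rvH : random_variable_space H.
Hypothesis subE : sublinear_expectation H E.
Implicit Types (X Y Z : T -> R) (a c : R).

Lemma rvs_cst c : H (fun=> c).
Proof.
by apply: (@rvs_comp _ _ _ rvH 0 (fun i _ => 0) (fun _ => c)) => [[]//|];
  exact: C_lLip_cst.
Qed.

Lemma rvs_comp1 f X : lLip1 f -> H X -> H (fun w => f (X w)).
Proof.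
move=> hf hX; have := @rvs_comp _ _ _ rvH 1 (fun=> X) _ (fun _ => hX) hf.
by under eq_fun do rewrite mxE.
Qed.

Lemma rvsM X Y : H X -> H Y -> H (fun w => X w * Y w).
Proof.
move=> hX hY; pose Z (i : 'I_2) := if i == 0 then X else Y.
have hZ i : H (Z i) by rewrite /Z; case: ifP.
have := rvs_comp rvH hZ (C_lLipM (C_lLip_coord ord0) (C_lLip_coord ord_max)).
by under eq_fun do rewrite !mxE.
Qed.

Lemma rvsN X : H X -> H (fun w => - X w).
Proof. by move=> /(rvsZ rvH (-1)); under eq_fun do rewrite mulN1r. Qed.

Lemma rvsB X Y : H X -> H Y -> H (fun w => X w - Y w).
Proof. by move=> hX hY; apply: (rvsD rvH) => //; exact: rvsN. Qed.

Lemma rvs_norm X : H X -> H (fun w => `|X w|).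
Proof. by move=> hX; exact: rvs_comp1 lLip1_norm hX. Qed.

Lemma rvs_max X Y : H X -> H Y -> H (fun w => Num.max (X w) (Y w)).
Proof.
move=> hX hY.
have := rvsD rvH hX (rvs_comp1 lLip1_maxr0 (rvsB hY hX)).
suff -> : (fun w => X w + Num.max 0 (Y w - X w)) = (fun w => Num.max (X w) (Y w)) by [].
by apply/funext => w; rewrite addr_maxr addr0 addrC subrK.
Qed.

Lemma rvs_shift_powR (e r : R) X : 0 <= e -> 0 <= r -> 0 < e \/ 1 <= r -> H X ->
  H (fun w => (`|X w| + e) `^ r).
Proof. by move=> e0 r0 er hX; exact: rvs_comp1 (lLip1_powR e0 r0 er) hX. Qed.

Lemma rvs_powR (p : R) X : 1 <= p -> H X -> H (fun w => `|X w| `^ p).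
Proof.
move=> p1 hX; have := @rvs_shift_powR 0 p X (lexx _) _ (or_intror p1) hX.
by under eq_fun do rewrite addr0; apply; lra.
Qed.

Lemma rvs_sum (s : seq nat) (Y : nat -> T -> R) :
  (forall i, i \in s -> H (Y i)) -> H (fun w => \sum_(i <- s) Y i w).
Proof.
elim: s => [_|i s ih hY]; first by under eq_fun do rewrite big_nil; exact: rvs_cst.
under eq_fun do rewrite big_cons; apply: (rvsD rvH); first by apply: hY; rewrite mem_head.
by apply: ih => j js; apply: hY; rewrite inE js orbT.
Qed.

Lemma rvs_bigmax (s : seq nat) Z (Y : nat -> T -> R) :
  H Z -> (forall i, i \in s -> H (Y i)) ->
  H (fun w => \big[Num.max/Z w]_(i <- s) Y i w).
Proof.
move=> hZ; elim: s => [_|i s ih hY]; first by under eq_fun do rewrite big_nil.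
under eq_fun do rewrite big_cons; apply: rvs_max; first by apply: hY; rewrite mem_head.
by apply: ih => j js; apply: hY; rewrite inE js orbT.
Qed.

(** The domain on which [E] behaves as a real-valued sublinear functional. *)
Definition L1 X := H X /\ (E (fun w => `|X w|%R) < +oo)%E.

Definition Ex X : R := fine (E X).

Lemma L1_rvs X : L1 X -> H X. Proof. by case. Qed.

Lemma L1_le X Y : H X -> L1 Y -> (forall w, `|X w| <= Y w) -> L1 X.
Proof.
move=> hX [hY fY] XY; split => //; apply: le_lt_trans fY.
apply: (sle_mono subE); [exact: rvs_norm|exact: rvs_norm|move=> w].
exact: le_trans (XY w) (ler_norm _).
Qed.

Lemma L1_cst c : L1 (fun=> c).
Proof. by split; [exact: rvs_cst|rewrite (sle_cst subE) ltry]. Qed.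

Lemma expect_ge0 X : H X -> (forall w, 0 <= X w) -> (0 <= E X)%E.
Proof.
move=> hX X0; have -> : 0%E = E (fun=> 0) by rewrite (sle_cst subE).
by apply: (sle_mono subE) => //; exact: rvs_cst.
Qed.

Lemma expect_fin X : L1 X -> E X = (Ex X)%:E.
Proof.
move=> [hX fX]; rewrite /Ex fineK//.
have h1 : (E X < +oo)%E.
  apply: le_lt_trans fX; apply: (sle_mono subE) => //; first exact: rvs_norm.
  by move=> w; exact: ler_norm.
have hN := rvsN hX.
have h2 : (E (fun w => - X w)%R < +oo)%E.
  apply: le_lt_trans fX; apply: (sle_mono subE) => //; first exact: rvs_norm.
  by move=> w; rewrite -normrN ler_norm.
(* [E X = -oo] would contradict [0 = E (X - X) <= E X + E (- X)]. *)
have := sle_subadd subE hX hN.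
have -> : (fun w => X w + - X w) = (fun=> 0) by apply/funext => w; rewrite subrr.
rewrite (sle_cst subE).
by case: (E X) h1 => [x||] //; case: (E (fun w => - X w)) h2 => [y||] // _ _ /(_ isT).
Qed.

Lemma expect_norm_fin X : L1 X -> L1 (fun w => `|X w|).
Proof.
move=> [hX fX]; split; first exact: rvs_norm.
by under eq_fun do rewrite normr_id.
Qed.

Lemma L1_fin X : H X -> (forall w, 0 <= X w) -> (E X < +oo)%E -> L1 X.
Proof.
move=> hX X0 fX; split => //.
by rewrite (_ : (fun w => _) = X)//; apply/funext => w; rewrite ger0_norm.
Qed.

Lemma L1D X Y : L1 X -> L1 Y -> L1 (fun w => X w + Y w).
Proof.
move=> hX hY; have hXY := rvsD rvH (L1_rvs hX) (L1_rvs hY); split => //.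
have nX := expect_norm_fin hX; have nY := expect_norm_fin hY.
apply: (@le_lt_trans _ _ (E (fun w => `|X w| + `|Y w|))).
  apply: (sle_mono subE); [|exact: rvs_norm|by move=> w; exact: ler_normD].
  by apply: (rvsD rvH); exact: L1_rvs.
apply: le_lt_trans (sle_subadd subE (L1_rvs nX) (L1_rvs nY) _) _;
  by rewrite !expect_fin//= ltry.
Qed.

Lemma L1Z a X : L1 X -> L1 (fun w => a * X w).
Proof.
move=> hX; split; first by apply: (rvsZ rvH); exact: L1_rvs.
under eq_fun do rewrite normrM.
have nX := expect_norm_fin hX.
by rewrite (sle_poshom subE)//; [rewrite expect_fin// ltry|exact: L1_rvs].
Qed.

Lemma L1N X : L1 X -> L1 (fun w => - X w).
Proof. by move=> /(L1Z (-1)); under eq_fun do rewrite mulN1r. Qed.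

Lemma L1_sum (s : seq nat) (Y : nat -> T -> R) :
  (forall i, i \in s -> L1 (Y i)) -> L1 (fun w => \sum_(i <- s) Y i w).
Proof.
elim: s => [_|i s ih hY]; first by under eq_fun do rewrite big_nil; exact: L1_cst.
under eq_fun do rewrite big_cons; apply: L1D; first by apply: hY; rewrite mem_head.
by apply: ih => j js; apply: hY; rewrite inE js orbT.
Qed.

Lemma Ex_cst c : Ex (fun=> c) = c.
Proof. by rewrite /Ex (sle_cst subE). Qed.

Lemma Ex_le X Y : L1 X -> L1 Y -> (forall w, X w <= Y w) -> Ex X <= Ex Y.
Proof.
move=> hX hY XY; rewrite -lee_fin -!expect_fin//.
by apply: (sle_mono subE) => //; exact: L1_rvs.
Qed.

Lemma Ex_ge0 X : L1 X -> (forall w, 0 <= X w) -> 0 <= Ex X.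
Proof. by move=> hX X0; rewrite -(Ex_cst 0); exact: Ex_le (L1_cst 0) hX X0. Qed.

Lemma ExD X Y : L1 X -> L1 Y -> Ex (fun w => X w + Y w) <= Ex X + Ex Y.
Proof.
move=> hX hY; rewrite -lee_fin EFinD -!expect_fin//; last exact: L1D.
by apply: (sle_subadd subE); [exact: L1_rvs|exact: L1_rvs|rewrite !expect_fin].
Qed.

Lemma ExZ a X : 0 <= a -> L1 X -> Ex (fun w => a * X w) = a * Ex X.
Proof.
move=> a0 hX; rewrite /Ex (sle_poshom subE)//; last exact: L1_rvs.
by rewrite expect_fin.
Qed.

Lemma Ex_sum (s : seq nat) (Y : nat -> T -> R) :
  (forall i, i \in s -> L1 (Y i)) ->
  Ex (fun w => \sum_(i <- s) Y i w) <= \sum_(i <- s) Ex (Y i).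
Proof.
elim: s => [_|i s ih hY].
  by under eq_fun do rewrite big_nil; rewrite big_nil Ex_cst.
have hs j : j \in s -> L1 (Y j) by move=> js; apply: hY; rewrite inE js orbT.
have hi : L1 (Y i) by apply: hY; rewrite mem_head.
under eq_fun do rewrite big_cons; rewrite big_cons.
by apply: le_trans (ExD hi (L1_sum hs)) _; rewrite lerD2l ih.
Qed.

Lemma Ex_addc c X : L1 X -> Ex (fun w => X w + c) = Ex X + c.
Proof.
move=> hX; apply/eqP; rewrite eq_le; apply/andP; split.
  by rewrite -[X in _ <= _ + X]Ex_cst; apply: ExD => //; exact: L1_cst.
rewrite -lerBrDr -[X in _ <= _ - X]Ex_cst Ex_cst -[X in _ <= _ + X]Ex_cst.
apply: le_trans (ExD (L1D hX (L1_cst c)) (L1_cst (- c))).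
by under [X in _ <= Ex X]eq_fun do rewrite addrK.
Qed.

Lemma Ex_leD2 X Y Z : L1 X -> L1 Y -> L1 Z -> (forall w, X w <= Y w + Z w) ->
  Ex X <= Ex Y + Ex Z.
Proof.
move=> hX hY hZ h; apply: le_trans (ExD hY hZ).
by apply: Ex_le => //; exact: L1D.
Qed.


Lemma Ex_norm_powR_ge0 (p : R) X : L1 (fun w => `|X w| `^ p) -> 0 <= Ex (fun w => `|X w| `^ p).
Proof. by move=> hX; apply: Ex_ge0 => // w; exact: powR_ge0. Qed.

(** * Dependence on the later variables *)

Section FutureFunctionals.
Variables (n k : nat).
Implicit Types (Phi : (nat -> R) -> R) (z : nat -> R).

(** The functionals of [(z_(k+1), ..., z_n)] to which dependence is applied.
They take whole sequences, so that functionals for different [k] live on one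
type; regularity is required along every regular family of coordinates, which
makes it stable under recursion on [k]. *)
Record future_functional Phi : Prop := FutureFunctional {
  future_lLip : forall m (c : nat -> 'rV[R]_m -> R),
    (forall i, C_lLip (c i)) -> C_lLip (fun y => Phi (c ^~ y)) ;
  future_mono : forall z z', (forall i, z i <= z' i) -> Phi z <= Phi z' ;
  future_local : forall z z', (forall i, (k < i <= n)%N -> z i = z' i) ->
    Phi z = Phi z' ;
  future_ge0 : forall z, 0 <= Phi z }.

Lemma future_powR Phi (e r : R) : 0 <= e -> 0 <= r -> 0 < e \/ 1 <= r ->
  future_functional Phi -> future_functional (fun z => (Phi z + e) `^ r).
Proof.
move=> e0 r0 er [hL hM hloc h0]; split => [m c hc|z z' zz'|z z' zz'|z].
- have := C_lLip_comp1 (lLip1_powR e0 r0 er) (hL m c hc).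
  by under eq_fun do rewrite ger0_norm//.
- by apply: ler_powR_base; rewrite ?lerD2r ?hM// addr_ge0.
- by rewrite (hloc _ _ zz').
- exact: powR_ge0.
Qed.

(** The vector [(z_(k+1), ..., z_n)] as a sequence; a local functional sees
none of the other entries. *)
Definition extend (y : 'rV[R]_(n - k)) (i : nat) : R :=
  if insub (i - k.+1)%N is Some j then y 0 j else 0.

Lemma extend_final (Y : nat -> T -> R) w i : (k < i <= n)%N ->
  extend (rvec (final Y n k) w) i = Y i w.
Proof.
move=> /andP[ki i_n]; rewrite /extend; case: insubP => [j _ ej|].
  by rewrite mxE /final ej subnKC.
by lia.
Qed.

Lemma future_extend (Y : nat -> T -> R) Phi : future_functional Phi -> forall w,
  Phi (extend (rvec (final Y n k) w)) = Phi (Y ^~ w).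
Proof. by move=> hPhi w; apply: (future_local hPhi) => i; exact: extend_final. Qed.

Lemma future_rvs (Y : nat -> T -> R) Phi : future_functional Phi ->
  (forall i, (k < i <= n)%N -> H (Y i)) -> H (fun w => Phi (Y ^~ w)).
Proof.
move=> hPhi hY; under eq_fun do rewrite -(future_extend Y hPhi).
apply: (rvs_comp rvH (phi := fun y => Phi (extend y))).
  by move=> i; apply: hY; have := ltn_ord i; lia.
apply: (future_lLip hPhi) => i; rewrite /extend.
by case: insubP => [j _ _|_]; [exact: C_lLip_coord|exact: C_lLip_cst].
Qed.

End FutureFunctionals.

(** The two processes used below, a running maximum and a running sum, are
computed from the last variable backwards. *)
Definition tail_fold (G : R -> R -> R) (n k : nat) (z : nat -> R) : R :=
  foldr (fun i v => G (z i) v) 0 (iota k.+1 (n - k)).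

Lemma tail_fold_end G n z : tail_fold G n n z = 0.
Proof. by rewrite /tail_fold subnn. Qed.

Lemma tail_fold_step G n k z : (k < n)%N ->
  tail_fold G n k z = G (z k.+1) (tail_fold G n k.+1 z).
Proof. by move=> kn; rewrite /tail_fold -(subnSK kn). Qed.

Lemma future_tail_fold G n k :
  (forall m (c d : 'rV[R]_m -> R), C_lLip c -> C_lLip d ->
     C_lLip (fun y => G (c y) (d y))) ->
  (forall x x' v v', x <= x' -> v <= v' -> G x v <= G x' v') ->
  (forall x v, 0 <= v -> 0 <= G x v) ->
  future_functional n k (tail_fold G n k).
Proof.
move=> hL hM h0; rewrite /tail_fold; split.
- move=> m c hc; elim: (iota _ _) => [|i s ih] /=; first exact: C_lLip_cst.
  exact: hL.
- by move=> z z' zz'; elim: (iota _ _) => [|i s ih] //=; exact: hM.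
- have : {subset iota k.+1 (n - k) <= [pred i | (k < i <= n)%N]}.
    move=> i; rewrite mem_iota inE.
    lia.
  elim: (iota _ _) => [|i s ih] //= hs z z' zz'.
  rewrite (zz' i); last by apply: hs; rewrite mem_head.
  by rewrite (ih _ z z')// => j js; apply: hs; rewrite inE js orbT.
- by move=> z; elim: (iota _ _) => [|i s ih] //=; exact: h0.
Qed.

Section ProductRule.
Variables (n : nat) (Y : nat -> T -> R).

(** The form in which dependence enters the moment recursions. The bound
is in terms of a nonnegative [c] above [Ex (f (Y k))], since this expectation may
be negative, a case that negative dependence does not cover. *)
Definition product_rule : Prop :=
  forall k Phi f c, (1 <= k <= n)%N -> future_functional n k Phi ->
  lLip1 f -> {homo f : x y / x <= y} ->
  0 <= c -> L1 (fun w => f (Y k w)) -> Ex (fun w => f (Y k w)) <= c ->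
  L1 (fun w => Phi (Y ^~ w)) -> L1 (fun w => f (Y k w) * Phi (Y ^~ w)) ->
  Ex (fun w => f (Y k w) * Phi (Y ^~ w)) <= c * Ex (fun w => Phi (Y ^~ w)).

Lemma future_end_cst Phi : future_functional n n Phi ->
  forall w, Phi (Y ^~ w) = Phi (fun=> 0).
Proof.
move=> hPhi w; apply: (future_local hPhi) => i /andP[ni i_n].
by move: (leq_trans ni i_n); rewrite ltnn.
Qed.

(** Negative dependence is applied to [f (Y k) - Ex (f (Y k))], of expectation
[0]; the term [Ex (f (Y k)) * Phi] is then put back. *)
Lemma neg_dep_product_rule :
  (forall k, (1 <= k < n)%N -> neg_dep_to E (single Y k) (final Y n k)) ->
  product_rule.
Proof.
move=> nd k Phi f c /andP[k1]; rewrite leq_eqVlt => /predU1P[{}k1|kn]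
  hPhi hf fmono c0 Lf fc LPhi LfPhi.
  (* No variable comes after [Y n]: [Phi] is constant. *)
  rewrite k1 in hPhi Lf fc LPhi LfPhi *.
  under eq_fun do rewrite (future_end_cst hPhi) mulrC.
  under [X in c * Ex X]eq_fun do rewrite (future_end_cst hPhi).
  rewrite Ex_cst ExZ ?(future_ge0 hPhi)// mulrC.
  by rewrite ler_wpM2r// (future_ge0 hPhi).
pose a := Ex (fun w => f (Y k w)).
pose phi1 (y : 'rV[R]_(n - k)) := Phi (extend y).
pose phi2 (x : 'rV[R]_1) := f (x 0 0) - a.
have phi1E w : phi1 (rvec (final Y n k) w) = Phi (Y ^~ w) by exact: future_extend.
have phi2E w : phi2 (rvec (single Y k) w) = f (Y k w) - a by rewrite /phi2 mxE.
have Lphi2 : L1 (fun w => f (Y k w) - a) by apply: L1D => //; exact: L1_cst.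
have e2 : Ex (fun w => f (Y k w) - a) = 0 by rewrite (Ex_addc (- a)) ?subrr.
have Lprod : L1 (fun w => Phi (Y ^~ w) * (f (Y k w) - a)).
  have := L1D LfPhi (L1Z (- a) LPhi).
  by under eq_fun do rewrite -mulrDl mulrC.
have C1 : C_lLip phi1.
  apply: (future_lLip hPhi) => i; rewrite /extend.
  by case: insubP => [j _ _|_]; [exact: C_lLip_coord|exact: C_lLip_cst].
have C2 : C_lLip phi2 by apply: C_lLipD => //; exact: C_lLip_cst.
have h : (E (fun w => phi1 (rvec (final Y n k) w) * phi2 (rvec (single Y k) w))%R <=
    E (fun w => phi1 (rvec (final Y n k) w)) * E (fun w => phi2 (rvec (single Y k) w)))%E.
  apply: (nd k _ phi1 phi2 C1 C2); first by rewrite k1 kn.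
  - by move=> w; exact: future_ge0 hPhi _.
  - by under eq_fun do rewrite phi2E; rewrite expect_fin// e2.
  - by under eq_fun do rewrite phi1E phi2E; case: Lprod.
  - by under eq_fun do rewrite phi1E; case: LPhi.
  - by under eq_fun do rewrite phi2E; case: Lphi2.
  - left; split=> i x y xy; last first.
      by rewrite (ord1 i) => xyi; rewrite /phi2 lerD2r; exact: fmono.
    move=> xyi; apply: (future_mono hPhi) => j; rewrite /extend.
    case: insubP => [l _ _|_] //.
    by have [->|li] := eqVneq l i; [|rewrite xy].
move: h; under eq_fun do rewrite phi1E phi2E.
under [X in (_ <= E X * _)%E]eq_fun do rewrite phi1E.
under [X in (_ <= _ * E X)%E]eq_fun do rewrite phi2E.
rewrite (expect_fin Lprod) (expect_fin Lphi2) e2 mule0 lee_fin => h.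
have := Ex_leD2 LfPhi Lprod (L1Z c LPhi).
rewrite ExZ// => /(_ _)/le_trans; apply; last by lra.
move=> w; have p0 := future_ge0 hPhi (Y ^~ w).
have : a * Phi (Y ^~ w) <= c * Phi (Y ^~ w) by rewrite ler_wpM2r.
lra.
Qed.

(** For fixed values of the later variables, [f (Y k) * Phi] is a nonnegative
multiple of [f (Y k)], so the inner expectation is computed by homogeneity. *)
Lemma indep_product (f : R -> R) k Phi : (1 <= k <= n)%N ->
  (forall k, (1 <= k < n)%N -> indep_to H E (single Y k) (final Y n k)) ->
  future_functional n k Phi -> lLip1 f ->
  L1 (fun w => f (Y k w)) -> L1 (fun w => Phi (Y ^~ w)) ->
  E (fun w => f (Y k w) * Phi (Y ^~ w))%R =
  E (fun w => Ex (fun w => f (Y k w)) * Phi (Y ^~ w))%R.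
Proof.
move=> /andP[k1 k_n] ind hPhi hf Lf LPhi.
move: k_n; rewrite leq_eqVlt => /predU1P[{}k1|kn].
  rewrite k1 in hPhi Lf LPhi *.
  under eq_fun do rewrite (future_end_cst hPhi) mulrC.
  under [X in _ = E X]eq_fun do rewrite (future_end_cst hPhi).
  rewrite (sle_cst subE) (sle_poshom subE) ?(future_ge0 hPhi)//; last exact: L1_rvs.
  by rewrite expect_fin// -EFinM mulrC.
pose phi (z : 'rV[R]_(n - k + 1)) := f (z 0 (rshift _ 0)) * Phi (extend (lsubmx z)).
have phiE (x : 'rV[R]_(n - k)) w :
    phi (row_mx x (rvec (single Y k) w)) = Phi (extend x) * f (Y k w).
  by rewrite /phi row_mxKl row_mxEr mxE mulrC.
have Cphi : C_lLip phi.
  apply: C_lLipM; first by apply: C_lLip_comp1 => //; exact: C_lLip_coord.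
  apply: (future_lLip hPhi (c := fun i (z : 'rV[R]_(n - k + 1)) => extend (lsubmx z) i)) => i.
  rewrite /extend; case: insubP => [j _ _|_]; last exact: C_lLip_cst.
  by under eq_fun do rewrite mxE; exact: C_lLip_coord.
have Labs := expect_norm_fin Lf.
have phibarE x : E (fun w => `|phi (row_mx x (rvec (single Y k) w))|) =
    (Phi (extend x) * Ex (fun w => `|f (Y k w)|))%:E.
  under eq_fun do rewrite phiE normrM ger0_norm ?(future_ge0 hPhi)//.
  rewrite (sle_poshom subE) ?(future_ge0 hPhi)//; last exact: L1_rvs.
  by rewrite (expect_fin Labs).
have phiYE x : E (fun w => phi (row_mx x (rvec (single Y k) w))) =
    (Phi (extend x) * Ex (fun w => f (Y k w)))%:E.
  under eq_fun do rewrite phiE.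
  rewrite (sle_poshom subE) ?(future_ge0 hPhi)//; last exact: L1_rvs.
  by rewrite (expect_fin Lf).
have := ind k _ phi Cphi; rewrite k1 kn => /(_ isT) /=.
have -> : (fun w => `|fine (E (fun w0 => `|phi (row_mx (rvec (final Y n k) w) (rvec (single Y k) w0))|))|) =
   (fun w => Ex (fun w => `|f (Y k w)|) * Phi (Y ^~ w)).
  apply/funext => w; rewrite phibarE (future_extend Y hPhi)/= mulrC ger0_norm//.
  by rewrite mulr_ge0 ?(future_ge0 hPhi)//; apply: Ex_ge0.
have -> : (fun w => fine (E (fun w0 => phi (row_mx (rvec (final Y n k) w) (rvec (single Y k) w0))))) =
   (fun w => Ex (fun w => f (Y k w)) * Phi (Y ^~ w)).
  by apply/funext => w; rewrite phiYE (future_extend Y hPhi)/= mulrC.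
have LL a : L1 (fun w => a * Phi (Y ^~ w)) by exact: L1Z.
have -> : (fun w => phi (row_mx (rvec (final Y n k) w) (rvec (single Y k) w))) =
   (fun w => f (Y k w) * Phi (Y ^~ w)).
  by apply/funext => w; rewrite phiE mulrC (future_extend Y hPhi).
apply; [|exact: L1_rvs|by rewrite expect_fin ?ltry|exact: L1_rvs].
by move=> x; rewrite phibarE ltry.
Qed.

Lemma indep_product_L1 (f : R -> R) k Phi : (1 <= k <= n)%N ->
  (forall k, (1 <= k < n)%N -> indep_to H E (single Y k) (final Y n k)) ->
  future_functional n k Phi -> lLip1 f ->
  L1 (fun w => f (Y k w)) -> L1 (fun w => Phi (Y ^~ w)) ->
  L1 (fun w => f (Y k w) * Phi (Y ^~ w)).
Proof.
move=> kn ind hPhi hf Lf LPhi; split; first by apply: rvsM; exact: L1_rvs.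
under eq_fun do rewrite normrM (ger0_norm (future_ge0 hPhi _)).
have hnf : lLip1 (fun x => `|f x|) by exact: C_lLip_comp1 lLip1_norm hf.
rewrite (@indep_product (fun x => `|f x|) k Phi kn ind hPhi hnf (expect_norm_fin Lf) LPhi).
by rewrite expect_fin ?ltry//; exact: L1Z.
Qed.

(** Integrability of the product is a conclusion here: independence computes the
expectation of [`|f (Y k)| * Phi] as well. *)
Lemma indep_product_rule :
  (forall k, (1 <= k < n)%N -> indep_to H E (single Y k) (final Y n k)) ->
  forall k Phi f c, (1 <= k <= n)%N -> future_functional n k Phi -> lLip1 f ->
  0 <= c -> L1 (fun w => f (Y k w)) -> Ex (fun w => f (Y k w)) <= c ->
  L1 (fun w => Phi (Y ^~ w)) ->
  L1 (fun w => f (Y k w) * Phi (Y ^~ w)) /\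
  Ex (fun w => f (Y k w) * Phi (Y ^~ w)) <= c * Ex (fun w => Phi (Y ^~ w)).
Proof.
move=> ind k Phi f c kn hPhi hf c0 Lf fc LPhi.
split; first exact: indep_product_L1.
rewrite /Ex (indep_product kn ind hPhi hf Lf LPhi) -!/(Ex _) -ExZ//.
apply: Ex_le; [exact: L1Z|exact: L1Z|] => w.
by rewrite ler_wpM2r// (future_ge0 hPhi).
Qed.

End ProductRule.


(** * Moments of the running maximum *)

Lemma norm_powR_fun Z (r : R) : (forall w, 0 <= Z w) ->
  (fun w => `|Z w| `^ r) = (fun w => Z w `^ r).
Proof. by move=> Z0; apply/funext => w; rewrite ger0_norm. Qed.

Section Moments.
Variable p : R.
Hypothesis p1 : 1 <= p.

Let p0 : 0 <= p. Proof. exact: le_trans ler01 p1. Qed.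

Definition Lp X := H X /\ L1 (fun w => `|X w| `^ p).

Lemma Lp_rvs X : Lp X -> H X. Proof. by case. Qed.

Lemma Lp_L1 X : Lp X -> L1 (fun w => `|X w| `^ p). Proof. by case. Qed.

Lemma Lp_le X Y : H X -> Lp Y -> (forall w, `|X w| <= `|Y w|) -> Lp X.
Proof.
move=> hX [hY lY] XY; split => //; apply: (L1_le _ lY); first exact: rvs_powR.
move=> w; rewrite ger0_norm ?powR_ge0//.
by apply: ler_powR_base; rewrite ?XY.
Qed.

Lemma Lp_cst c : Lp (fun=> c).
Proof. by split; [exact: rvs_cst|exact: L1_cst]. Qed.

Lemma LpD X Y : Lp X -> Lp Y -> Lp (fun w => X w + Y w).
Proof.
move=> [hX lX] [hY lY]; have hXY := rvsD rvH hX hY; split => //.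
apply: (L1_le (rvs_powR p1 hXY) (L1Z (2 `^ p) (L1D lX lY))) => w.
rewrite ger0_norm ?powR_ge0//; apply: le_trans (powRD_le _ _ _) => //.
by apply: ler_powR_base => //; exact: ler_normD.
Qed.

Lemma Lp_norm X : Lp X -> Lp (fun w => `|X w|).
Proof.
move=> hX; apply: (Lp_le (rvs_norm (Lp_rvs hX)) hX) => w.
by rewrite normr_id.
Qed.

Lemma LpN X : Lp X -> Lp (fun w => - X w).
Proof.
by move=> hX; apply: (Lp_le (rvsN (Lp_rvs hX)) hX) => w; rewrite normrN.
Qed.

Lemma Lp_sum (s : seq nat) (Y : nat -> T -> R) :
  (forall i, i \in s -> Lp (Y i)) -> Lp (fun w => \sum_(i <- s) Y i w).
Proof.
elim: s => [_|i s ih hY]; first by under eq_fun do rewrite big_nil; exact: Lp_cst.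
under eq_fun do rewrite big_cons; apply: LpD; first by apply: hY; rewrite mem_head.
by apply: ih => j js; apply: hY; rewrite inE js orbT.
Qed.

Lemma Lp_lower (r : R) X : Lp X -> 0 <= r -> r <= p -> H (fun w => `|X w| `^ r) ->
  L1 (fun w => `|X w| `^ r).
Proof.
move=> [hX lX] r0 rp hr; apply: (L1_le hr (L1D (L1_cst 1) lX)) => w.
rewrite ger0_norm ?powR_ge0//; have := powR_ge0 `|X w| p.
have [x1|/ltW x1] := lerP 1 `|X w|.
  by have := ler_powR x1 rp; lra.
have : `|X w| `^ r <= 1 `^ r by exact: ler_powR_base.
by rewrite powR1; lra.
Qed.

Lemma Lp_id X : Lp X -> L1 X.
Proof.
move=> hX; have hn := rvs_norm (Lp_rvs hX).
have e : (fun w => `|X w| `^ 1) = (fun w => `|X w|) by apply/funext => w; rewrite powRr1.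
have := @Lp_lower 1 X hX ler01 p1; rewrite e => /(_ hn) [_ h].
by split; [exact: Lp_rvs hX|move: h; under eq_fun do rewrite normr_id].
Qed.

(** Young: [|x| t^(p-1) <= |x|^p + t^p]. *)
Lemma L1_young X Z (e : R) : 0 <= e -> Lp X -> Lp Z -> (forall w, 0 <= Z w) ->
  H (fun w => (Z w + e) `^ (p - 1)) ->
  L1 (fun w => X w * (Z w + e) `^ (p - 1)).
Proof.
move=> e0 hX hZ Z0 hZp.
have lZ := Lp_L1 (LpD hZ (Lp_cst e)).
apply: (L1_le _ (L1D lZ (Lp_L1 hX))); first by apply: rvsM => //; exact: Lp_rvs.
move=> w; have z0 : 0 <= Z w + e by rewrite addr_ge0.
rewrite normrM (ger0_norm (powR_ge0 _ _)) (ger0_norm z0).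
have := @young_split R `|X w| (Z w + e) 1 p 1 (normr_ge0 _) z0 ltr01 ltr01 p1.
by rewrite powR1 !mul1r divr1.
Qed.

End Moments.

Lemma Lp_sqr (p : R) X : 2 <= p -> Lp p X -> L1 (fun w => X w ^+ 2).
Proof.
move=> p2 hX; have p1 : 1 <= p by lra.
have e : (fun w => `|X w| `^ 2) = (fun w => X w ^+ 2).
  by apply/funext => w; rewrite -[2]/(2%:R) powR_mulrn// real_normK// num_real.
have := Lp_lower hX (ler0n _ 2) p2; rewrite e; apply.
have hh := rvsM (Lp_rvs hX) (Lp_rvs hX).
by under eq_fun do rewrite expr2.
Qed.

(** The positive part of the maximum of the sums
[z_(k+1), z_(k+1) + z_(k+2), ..., z_(k+1) + ... + z_n]. *)
Definition future_max : nat -> nat -> (nat -> R) -> R :=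
  tail_fold (fun x v => Num.max 0 (x + v)).

Lemma future_max_future n k : future_functional n k (future_max n k).
Proof.
apply: future_tail_fold => [m c d hc hd|x x' v v' xx' vv'|x v v0].
- by apply: C_lLip_comp1; [exact: lLip1_maxr0|exact: C_lLipD].
- by rewrite ge_max !le_max lexx /=; apply/orP; right; exact: lerD.
- by rewrite le_max lexx.
Qed.

Lemma future_max_ge0 n k z : 0 <= future_max n k z.
Proof. exact: future_ge0 (future_max_future n k) z. Qed.

Lemma future_max_end n z : future_max n n z = 0.
Proof. exact: tail_fold_end. Qed.

Lemma future_max_step n k z : (k < n)%N ->
  future_max n k z = Num.max 0 (z k.+1 + future_max n k.+1 z).
Proof. exact: tail_fold_step. Qed.

Lemma future_max_le n k z : (k < n)%N ->
  future_max n k z <= `|z k.+1 + future_max n k.+1 z|.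
Proof. by move=> kn; rewrite future_max_step// ge_max normr_ge0 ler_norm. Qed.

Section FutureMaxMoments.
Variables (p : R) (n : nat) (Y : nat -> T -> R).
Hypothesis p1 : 1 <= p.
Hypothesis LpY : forall k, (1 <= k <= n)%N -> Lp p (Y k).

Let HY k : (1 <= k <= n)%N -> H (Y k). Proof. by move=> /LpY /Lp_rvs. Qed.

Lemma future_max_rvs k : H (fun w => future_max n k (Y ^~ w)).
Proof.
apply: (future_rvs (future_max_future n k)) => i /andP[ki i_n].
by apply: HY; rewrite i_n andbT; lia.
Qed.

Lemma future_max_Lp k : (k <= n)%N -> Lp p (fun w => future_max n k (Y ^~ w)).
Proof.
move: k; apply: down_ind => [|k kn ih].
  by under eq_fun do rewrite future_max_end; exact: Lp_cst.
have hD := LpD p1 (LpY (k := k.+1) kn) ih.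
apply: (Lp_le p1 (future_max_rvs k) hD) => w.
by rewrite ger0_norm ?future_max_ge0//; exact: future_max_le.
Qed.

Lemma future_max_L1 k : (k <= n)%N -> L1 (fun w => future_max n k (Y ^~ w) `^ p).
Proof.
move=> /future_max_Lp /Lp_L1; rewrite norm_powR_fun// => w.
exact: future_max_ge0.
Qed.

End FutureMaxMoments.

(** * Maxima of partial sums *)

Section PartialSums.
Variables (Y : nat -> T -> R) (w : T).

Lemma psum0 : psum Y 0 w = 0.
Proof. by rewrite /psum big_nil. Qed.

Lemma psumS k : psum Y k.+1 w = psum Y k w + Y k.+1 w.
Proof. by rewrite /psum big_nat_recr. Qed.

Lemma psumN k : psum (fun i w => - Y i w) k w = - psum Y k w.
Proof. by rewrite /psum sumrN. Qed.

Lemma future_max_ge n k j : (k <= j <= n)%N ->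
  psum Y j w - psum Y k w <= future_max n k (Y ^~ w).
Proof.
move=> /andP[kj jn]; have kn := leq_trans kj jn.
move: k kn kj; apply: down_ind => [nj|k kn ih].
  by rewrite (_ : j = n) ?subrr ?future_max_ge0//; lia.
rewrite leq_eqVlt => /predU1P[->|kj]; first by rewrite subrr future_max_ge0.
have := ih kj; rewrite psumS => h; rewrite future_max_step// le_max.
by apply/orP; right; lra.
Qed.

Lemma future_max_attained n k : (k <= n)%N ->
  exists2 j, (k <= j <= n)%N & future_max n k (Y ^~ w) = psum Y j w - psum Y k w.
Proof.
move: k; apply: down_ind => [|k kn [j /andP[kj jn] e]].
  by exists n; rewrite ?leqnn// future_max_end subrr.
rewrite future_max_step// e psumS.
case: (lerP 0 (Y k.+1 w + _)) => h.
  by exists j; [rewrite (ltnW kj)|ring].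
by exists k; [rewrite leqnn ltnW|rewrite subrr].
Qed.

Lemma max_psumE n : (0 < n)%N ->
  max_psum Y n w = Y 1 w + future_max n 1 (Y ^~ w).
Proof.
move=> n0; have e1 : psum Y 1 w = Y 1 w by rewrite psumS psum0 add0r.
apply/eqP; rewrite eq_le; apply/andP; split; rewrite /max_psum.
  rewrite big_nat; apply: bigmax_le => [|j /andP[j1 jn]].
    by rewrite e1 lerDl future_max_ge0.
  have := @future_max_ge n 1 j; rewrite j1 -ltnS jn e1 => /(_ isT); lra.
have [j /andP[j1 jn] ->] := future_max_attained n0.
rewrite e1 addrC subrK; apply: (le_bigmax_seq _ _ _ (fun k => psum Y k w)) => //.
by rewrite mem_index_iota j1 ltnS.
Qed.

Lemma psum_le_max_abs n j : (1 <= j <= n)%N -> `|psum Y j w| <= max_abs_psum Y n w.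
Proof.
move=> jn; apply: (le_bigmax_seq _ _ _ (fun k => `|psum Y k w|)) => //.
by rewrite mem_index_iota ltnS.
Qed.

Lemma max_abs_psum_ge0 n : 0 <= max_abs_psum Y n w.
Proof. by apply: le_trans (normr_ge0 (psum Y 1 w)) _; exact: bigmax_ge_id. Qed.

Lemma psum_le_max_abs0 n j : (j <= n)%N -> `|psum Y j w| <= max_abs_psum Y n w.
Proof.
case: j => [|j] jn; first by rewrite psum0 normr0 max_abs_psum_ge0.
exact: psum_le_max_abs.
Qed.

Lemma future_max_le_max_abs n k : (k <= n)%N ->
  future_max n k (Y ^~ w) <= 2 * max_abs_psum Y n w.
Proof.
move=> kn; have [j /andP[_ jn] ->] := future_max_attained kn.
have := psum_le_max_abs0 kn; have := psum_le_max_abs0 jn; rewrite !ler_norml; lra.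
Qed.

Lemma max_abs_psum_le_sum n : (0 < n)%N ->
  max_abs_psum Y n w <= \sum_(1 <= i < n.+1) `|Y i w|.
Proof.
move=> n0; rewrite /max_abs_psum big_nat.
suff h j : (j <= n)%N -> `|psum Y j w| <= \sum_(1 <= i < n.+1) `|Y i w|.
  by apply: bigmax_le => [|j /andP[_ jn]]; exact: h.
move=> jn; apply: le_trans (ler_norm_sum _ _ _) _.
by rewrite (@big_cat_nat _ _ _ j.+1 1 n.+1)//= lerDl sumr_ge0.
Qed.

End PartialSums.

Lemma max_abs_psum_le (Y : nat -> T -> R) n w : (0 < n)%N ->
  max_abs_psum Y n w <=
    Num.max (future_max n 0 (Y ^~ w)) (future_max n 0 (fun i => - Y i w)).
Proof.
move=> n0; rewrite /max_abs_psum big_nat.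
suff h j : (j <= n)%N -> `|psum Y j w| <= 
    Num.max (future_max n 0 (Y ^~ w)) (future_max n 0 (fun i => - Y i w)).
  by apply: bigmax_le => [|j /andP[_ jn]]; exact: h.
move=> jn; rewrite le_max.
have h1 := @future_max_ge Y w n 0 j jn.
have h2 := @future_max_ge (fun i w => - Y i w) w n 0 j jn.
rewrite !psum0 !subr0 psumN in h1 h2.
case: (lerP 0 (psum Y j w)) => h; first by rewrite (ger0_norm h) h1.
by rewrite (ltr0_norm h) h2 orbT.
Qed.


(** * Variables of nonpositive expectation *)

Lemma shift_powR_L1 (p e r : R) Z : 1 <= p -> 0 <= e -> 0 <= r -> r <= p -> 0 < e \/ 1 <= r ->
  Lp p Z -> (forall w, 0 <= Z w) -> L1 (fun w => (Z w + e) `^ r).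
Proof.
move=> p1 e0 r0 rp er hZ Z0; have Ze0 w : 0 <= Z w + e by rewrite addr_ge0.
have h := Lp_lower (LpD p1 hZ (Lp_cst p e)) r0 rp.
rewrite -(norm_powR_fun r Ze0); apply: h; rewrite norm_powR_fun//.
have := rvs_shift_powR e0 r0 er (Lp_rvs hZ).
by under eq_fun do rewrite (ger0_norm (Z0 _)).
Qed.

(** The shift [e] makes the power [p - 1] locally Lipschitz when [p < 2]. *)
Lemma linear_term (p e a : R) n (Y : nat -> T -> R) k : 1 <= p -> 0 <= e ->
  0 < e \/ 2 <= p -> (forall i, (1 <= i <= n)%N -> Lp p (Y i)) -> (k < n)%N ->
  product_rule n Y -> 0 <= a -> Ex (Y k.+1) <= a ->
  [/\ L1 (fun w => (future_max n k.+1 (Y ^~ w) + e) `^ (p - 1)),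
      L1 (fun w => Y k.+1 w * (future_max n k.+1 (Y ^~ w) + e) `^ (p - 1)) &
      Ex (fun w => Y k.+1 w * (future_max n k.+1 (Y ^~ w) + e) `^ (p - 1)) <=
      a * Ex (fun w => (future_max n k.+1 (Y ^~ w) + e) `^ (p - 1))].
Proof.
move=> p1 e0 ep LpY kn pr a0 Ea.
have LpV := future_max_Lp p1 LpY kn.
have V0 w := future_max_ge0 n k.+1 (Y ^~ w).
have r0 : 0 <= p - 1 by lra.
have er : 0 < e \/ 1 <= p - 1 by case: ep; [left|right; lra].
have L := shift_powR_L1 p1 e0 r0 (_ : p - 1 <= p) er LpV V0.
have {}L : L1 (fun w => (future_max n k.+1 (Y ^~ w) + e) `^ (p - 1)) by apply: L; lra.
have LYV := L1_young p1 e0 (LpY k.+1 kn) LpV V0 (L1_rvs L).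
split => //; apply: (pr k.+1 (fun z => (future_max n k.+1 z + e) `^ (p - 1)) id) => //.
- exact: future_powR e0 r0 er (future_max_future n k.+1).
- exact: lLip1_id.
- by have := Lp_id p1 (LpY k.+1 kn).
Qed.

Lemma sum_moments_ge0 (p : R) n (Y : nat -> T -> R) :
  (forall i, (1 <= i <= n)%N -> Lp p (Y i)) ->
  0 <= \sum_(0 <= k < n) Ex (fun w => `|Y k.+1 w| `^ p).
Proof.
move=> LpY; rewrite big_nat sumr_ge0// => k kn.
by apply: Ex_norm_powR_ge0; exact: (Lp_L1 (LpY k.+1 kn)).
Qed.

Lemma le_eps_limit (A B C : R) : 0 <= C ->
  (forall e, 0 < e -> e <= 1 -> A <= B + e * C) -> A <= B.
Proof.
move=> C0 h; rewrite leNgt; apply/negP => BA.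
pose e := Num.min 1 ((A - B) / (2 * (C + 1))).
have c0 : 0 < 2 * (C + 1) by lra.
have e0 : 0 < e by rewrite lt_min ltr01 divr_gt0//; lra.
have e1 : e <= 1 by rewrite ge_min lexx.
have e2 : e * (2 * (C + 1)) <= A - B by rewrite -ler_pdivlMr// ge_min lexx orbT.
have := h e e0 e1; nra.
Qed.

Section DriftFree.
Variables (n : nat) (Y : nat -> T -> R).
Hypothesis n0 : (0 < n)%N.
Hypothesis drift : forall i, (1 <= i <= n)%N -> Ex (Y i) <= 0.

Local Notation V k w := (future_max n k (Y ^~ w)).

(** The recursion is run for the shifted maxima [V k + e], whose powers are
locally Lipschitz, and [e] then tends to [0]. *)
Lemma moment_bound_le2 (p : R) : 1 <= p -> p <= 2 ->
  product_rule n Y -> (forall i, (1 <= i <= n)%N -> Lp p (Y i)) ->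
  Ex (fun w => `|Y 1 w + V 1 w| `^ p) <=
  2 `^ (2 - p) * \sum_(0 <= k < n) Ex (fun w => `|Y k.+1 w| `^ p).
Proof.
move=> p1 p2 pr LpY.
have LpV k : (k <= n)%N -> Lp p (fun w => V k w) by exact: future_max_Lp.
have V0 k w := future_max_ge0 n k (Y ^~ w).
have LpZ : Lp p (fun w => Y 1 w + V 1 w) by have := LpD p1 (LpY 1%N n0) (LpV 1%N n0).
have LZ1 := Lp_L1 (LpD p1 (Lp_norm p1 LpZ) (Lp_cst p 1)).
set c := 2 `^ (2 - p); have c0 : 0 <= c by exact: powR_ge0.
apply: (@le_eps_limit _ _ (n%:R + p * Ex (fun w => `| `|Y 1 w + V 1 w| + 1| `^ p))).
  have Q0 : 0 <= Ex (fun w => `| `|Y 1 w + V 1 w| + 1| `^ p) by exact: Ex_norm_powR_ge0.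
  by rewrite addr_ge0// mulr_ge0//; lra.
move=> e e0 e1; have e0' := ltW e0.
have LYVe k : (k < n)%N -> L1 (fun w => `|Y k.+1 w + V k.+1 w + e| `^ p).
  by move=> kn; have := Lp_L1 (LpD p1 (LpD p1 (LpY k.+1 kn) (LpV k.+1 kn)) (Lp_cst p e)).
have LVe k : (k <= n)%N -> L1 (fun w => (V k w + e) `^ p).
  by move=> kn; apply: (shift_powR_L1 p1) => //; [lra|left|exact: LpV].
(* The term [e `^ p] accounts for the case where the maximum in [V k] is [0]. *)
have := @backward_gronwall R n
  (fun k => Ex (fun w => `|Y k.+1 w + V k.+1 w + e| `^ p) + e `^ p)
  (fun k => Ex (fun w => (V k w + e) `^ p)) (fun=> 0)
  (fun k => c * Ex (fun w => `|Y k.+1 w| `^ p) + e `^ p) n0.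
have -> : Ex (fun w => (V n w + e) `^ p) = e `^ p.
  by under eq_fun do rewrite future_max_end add0r; rewrite Ex_cst.
rewrite big1// expR0 mul1r big_split/= -mulr_sumr sumr_const_nat subn0 => h.
have {}h : Ex (fun w => `|Y 1 w + V 1 w + e| `^ p) <=
    c * \sum_(0 <= k < n) Ex (fun w => `|Y k.+1 w| `^ p) + e `^ p *+ n.
  rewrite -(lerD2r (e `^ p)) [leRHS]addrC; apply: h => //.
  - by move=> k kn; rewrite addr_ge0 ?powR_ge0// mulr_ge0//;
      exact: (Ex_norm_powR_ge0 (Lp_L1 (LpY k.+1 kn))).
  - move=> k kn; rewrite addr0 mul1r addrA lerD2r.
    have [_ LYV EYV] := linear_term p1 e0' (or_introl e0) LpY kn pr (lexx 0) (drift (i := k.+1) kn).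
    apply: (@le_trans _ _ (Ex (fun w => (V k.+1 w + e) `^ p + c * `|Y k.+1 w| `^ p) +
       Ex (fun w => p * (Y k.+1 w * (V k.+1 w + e) `^ (p - 1))))).
      apply: Ex_leD2 => //.
      + exact: LYVe.
      + by apply: L1D; [exact: LVe|exact: (L1Z _ (Lp_L1 (LpY k.+1 kn)))].
      + exact: L1Z.
      move=> w; rewrite -addrA.
      have Ve : 0 < V k.+1 w + e by have := V0 k.+1 w; lra.
      by have := powR_normD_le2 (Y k.+1 w) p1 p2 Ve; rewrite -/c; lra.
    rewrite (ExZ _ LYV); last by lra.
    rewrite mul0r in EYV.
    have := ExD (LVe k.+1 kn) (L1Z c (Lp_L1 (LpY k.+1 kn))).
    rewrite (ExZ c0 (Lp_L1 (LpY k.+1 kn))).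
    have : p * Ex (fun w => Y k.+1 w * (V k.+1 w + e) `^ (p - 1)) <= 0.
      by rewrite mulr_ge0_le0//; lra.
    lra.
  - move=> k /andP[k0 kn].
    have -> : e `^ p = Ex (fun=> e `^ p) by rewrite Ex_cst.
    apply: Ex_leD2; [exact: LVe (ltnW kn)|exact: LYVe|exact: L1_cst|move=> w].
    rewrite (future_max_step _ kn); have := powR_ge0 e p => ep.
    case: (lerP 0 (Y k.+1 w + _)) => hw.
      by rewrite ger0_norm; [lra|rewrite addr_ge0].
    by rewrite add0r lerDr powR_ge0.
  - exact: powR_ge0.
have {}h : Ex (fun w => `|Y 1 w + V 1 w + e| `^ p) <=
    c * \sum_(0 <= k < n) Ex (fun w => `|Y k.+1 w| `^ p) + e * n%:R.
  apply: le_trans h _; rewrite lerD2l -mulr_natr ler_wpM2r//.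
  by apply: ge1r_powR => //; rewrite e0.
rewrite mulrDr addrA; apply: le_trans (lerD h (lexx _)).
have -> : e * (p * Ex (fun w => `| `|Y 1 w + V 1 w| + 1| `^ p)) =
   Ex (fun w => (e * p) * `| `|Y 1 w + V 1 w| + 1| `^ p).
  by rewrite ExZ ?mulrA// mulr_ge0//; lra.
apply: Ex_leD2; [exact: (Lp_L1 LpZ)|exact: LYVe|exact: L1Z|move=> w].
set z := Y 1 w + V 1 w.
have := powR_lipschitz (normr_ge0 z) (normr_ge0 (z + e)) p1.
have h1 : `| `|z| - `|z + e| | <= e.
  apply: le_trans (ler_dist_dist _ _) _.
  by rewrite opprD addrA subrr sub0r normrN ger0_norm.
have h2 : Num.max `|z| `|z + e| `^ (p - 1) <= `| `|z| + 1| `^ p.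
  have z1 : 1 <= `|z| + 1 by have := normr_ge0 z; lra.
  rewrite (ger0_norm (_ : 0 <= `|z| + 1)); last by lra.
  apply: le_trans (ler_powR z1 (_ : p - 1 <= p)); last by lra.
  apply: ler_powR_base; [lra|by rewrite le_max normr_ge0|].
  rewrite ge_max; apply/andP; split; first by lra.
  by apply: le_trans (ler_normD _ _) _; rewrite (ger0_norm e0'); lra.
move=> h3; have {}h3 := le_trans (ler_norm _) h3.
have h4 : p * Num.max `|z| `|z + e| `^ (p - 1) * `| `|z| - `|z + e| | <=
    p * `| `|z| + 1| `^ p * e.
  by apply: ler_pM => //; rewrite ?mulr_ge0 ?powR_ge0 ?ler_wpM2l//; lra.
lra.
Qed.


Lemma le_step_Lp (p : R) k : 1 <= p -> (forall i, (1 <= i <= n)%N -> Lp p (Y i)) ->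
  (k < n)%N -> L1 (fun w => `|Y k.+1 w + V k.+1 w| `^ p) /\
  Ex (fun w => V k w `^ p) <= Ex (fun w => `|Y k.+1 w + V k.+1 w| `^ p).
Proof.
move=> p1 LpY kn; have := Lp_L1 (LpD p1 (LpY k.+1 kn) (future_max_Lp p1 LpY kn)).
move=> L; split => //; apply: (Ex_le (future_max_L1 p1 LpY (ltnW kn)) L) => w.
 apply: ler_powR_base; [lra|exact: future_max_ge0|exact: future_max_le].
Qed.

Lemma future_max_end_moment (p : R) : 2 <= p -> Ex (fun w => V n w `^ p) = 0.
Proof.
move=> p2; have p0 : p != 0 by lra.
by under eq_fun do rewrite future_max_end powR0//; rewrite Ex_cst.
Qed.

(** Every step of the recursion multiplies the previous moment by at most
[1 + n^-1], hence the [n] steps by [expR 1]. *)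
Lemma moment_bound_ge2 (p : R) : 2 <= p ->
  product_rule n Y -> (forall i, (1 <= i <= n)%N -> Lp p (Y i)) ->
  Ex (fun w => `|Y 1 w + V 1 w| `^ p) <=
  expR 1 * (2 * taylorK p `^ (p / 2)) * n%:R `^ (p / 2 - 1) *
    \sum_(0 <= k < n) Ex (fun w => `|Y k.+1 w| `^ p).
Proof.
move=> p2 pr LpY; have p1 : 1 <= p by lra.
have N1 : 1 <= n%:R :> R by rewrite ler1n.
have p0 : 0 <= p by lra.
set c := 2 * taylorK p `^ (p / 2) * n%:R `^ (p / 2 - 1).
have c0 : 0 <= c by rewrite /c !mulr_ge0// powR_ge0.
have := @backward_gronwall R n (fun k => Ex (fun w => `|Y k.+1 w + V k.+1 w| `^ p))
  (fun k => Ex (fun w => V k w `^ p)) (fun=> n%:R^-1)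
  (fun k => c * Ex (fun w => `|Y k.+1 w| `^ p)) n0.
rewrite future_max_end_moment// add0r -mulr_sumr sumr_const_nat subn0.
have -> : (n%:R^-1 : R) *+ n = 1 by rewrite -[LHS]mulr_natr mulVf//; lra.
have -> : expR 1 * (2 * taylorK p `^ (p / 2)) * n%:R `^ (p / 2 - 1) *
  \sum_(0 <= k < n) Ex (fun w => `|Y k.+1 w| `^ p) =
  expR 1 * (c * \sum_(0 <= k < n) Ex (fun w => `|Y k.+1 w| `^ p)) by rewrite /c; ring.
apply => //.
- by move=> k kn; rewrite mulr_ge0//; exact: (Ex_norm_powR_ge0 (Lp_L1 (LpY k.+1 kn))).
- move=> k kn; have [LD _] := le_step_Lp p1 LpY kn.
  have [_ LYV EYV] := linear_term p1 (lexx 0) (or_intror p2) LpY kn pr (lexx 0) (drift (i := k.+1) kn).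
  have LV := future_max_L1 p1 LpY (k := k.+1) kn.
  have LY := Lp_L1 (LpY k.+1 kn).
  have i0 : 0 <= 1 + n%:R^-1 :> R by rewrite addr_ge0.
  have L2 := L1D (L1Z (1 + n%:R^-1) LV) (L1Z c LY).
  apply: (@le_trans _ _ (Ex (fun w => (1 + n%:R^-1) * V k.+1 w `^ p + c * `|Y k.+1 w| `^ p) +
       Ex (fun w => p * (Y k.+1 w * (V k.+1 w + 0) `^ (p - 1))))).
    apply: (Ex_leD2 LD L2 (L1Z p LYV)) => w.
    rewrite addr0; have := powR_normD_ge2_scaled (Y k.+1 w) p2 N1 (future_max_ge0 n k.+1 (Y ^~ w)).
    rewrite -/c; lra.
  have := ExD (L1Z (1 + n%:R^-1) LV) (L1Z c LY).
  rewrite !ExZ//.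
  rewrite mul0r in EYV; have := mulr_ge0_le0 p0 EYV; lra.
- by move=> k /andP[_ kn]; have [_] := le_step_Lp p1 LpY kn.
Qed.

(** Independence factors the quadratic term exactly, so that the second moments
only enter through their sum, the scale of the recursion. *)
Lemma indep_moment_bound (p : R) : 2 <= p ->
  (forall k, (1 <= k < n)%N -> indep_to H E (single Y k) (final Y n k)) ->
  (forall i, (1 <= i <= n)%N -> Lp p (Y i)) ->
  Ex (fun w => `|Y 1 w + V 1 w| `^ p) <=
  expR (taylorK p) * taylorK p *
    (\sum_(0 <= k < n) Ex (fun w => `|Y k.+1 w| `^ p) +
     (\sum_(0 <= k < n) Ex (fun w => Y k.+1 w ^+ 2)) `^ (p / 2)).
Proof.
move=> p2 ind LpY; have p1 : 1 <= p by lra.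
have p0 : 0 <= p by lra.
have K1 := taylorK_ge1 p; have K0 : 0 <= taylorK p by lra.
have rule := indep_product_rule ind.
have L2 k (kn : (k < n)%N) : L1 (fun w => Y k.+1 w ^+ 2) by exact: Lp_sqr p2 (LpY k.+1 kn).
have b0 k : (k < n)%N -> 0 <= Ex (fun w => Y k.+1 w ^+ 2).
  by move=> kn; apply: Ex_ge0 (L2 k kn) _ => w; exact: sqr_ge0.
have pr : product_rule n Y.
  by move=> k Phi f c kn hPhi hf _ c0 Lf Ef LPhi _; have [] := rule k Phi f c kn hPhi hf c0 Lf Ef LPhi.
apply: (@backward_gronwall_scaled R n (fun k => Ex (fun w => `|Y k.+1 w + V k.+1 w| `^ p))
  (fun k => Ex (fun w => V k w `^ p))) => //.
- by lra.
- by move=> k kn; exact: (Ex_norm_powR_ge0 (Lp_L1 (LpY k.+1 kn))).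
- move=> B k B0 kn; have [LD _] := le_step_Lp p1 LpY kn.
  have [_ LYV EYV] := linear_term p1 (lexx 0) (or_intror p2) LpY kn pr (lexx 0) (drift (i := k.+1) kn).
  have LV := future_max_L1 p1 LpY (k := k.+1) kn.
  have LY := Lp_L1 (LpY k.+1 kn).
  have sq : lLip1 (fun x : R => x ^+ 2) by apply: C_lLipM; exact: C_lLip_coord.
  have hPhi : future_functional n k.+1 (fun z => (future_max n k.+1 z + 0) `^ p).
    by apply: future_powR (future_max_future n k.+1) => //; right.
  have eV : (fun w => (V k.+1 w + 0) `^ p) = (fun w => V k.+1 w `^ p).
    by apply/funext => w; rewrite addr0.
  have := rule k.+1 _ (fun x => x ^+ 2) _ kn hPhi sq (b0 k kn) (L2 k kn) (lexx _).
  rewrite eV => /(_ LV) [].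
  have -> : (fun w => Y k.+1 w ^+ 2 * (V k.+1 w + 0) `^ p) =
    (fun w => Y k.+1 w ^+ 2 * V k.+1 w `^ p) by apply/funext => w; rewrite addr0.
  move=> LQ EQ.
  set K := taylorK p in K1 K0 *; set b := Ex (fun w => Y k.+1 w ^+ 2) in EQ *.
  have KB : 0 <= K / B by rewrite divr_ge0// ltW.
  have KB' : 0 <= K * B `^ (p / 2 - 1) by rewrite mulr_ge0// powR_ge0.
  have LA := L1D LV (L1Z K LY).
  have LB := L1D (L1Z (K / B) LQ) (L1Z (K * B `^ (p / 2 - 1)) (L2 k kn)).
  have LC := L1D (L1Z p LYV) LB.
  have h2 := ExD LV (L1Z K LY).
  have h3 := ExD (L1Z p LYV) LB.
  have h4 := ExD (L1Z (K / B) LQ) (L1Z (K * B `^ (p / 2 - 1)) (L2 k kn)).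
  rewrite (ExZ K0 LY) in h2; rewrite (ExZ p0 LYV) in h3.
  rewrite (ExZ KB LQ) (ExZ KB' (L2 k kn)) -/b in h4.
  rewrite mul0r in EYV; have h5 := mulr_ge0_le0 p0 EYV.
  have h6 := ler_wpM2l KB EQ.
  apply: le_trans (Ex_leD2 LD LA LC _) _.
    move=> w; have := powR_normD_ge2_split (Y k.+1 w) p2 B0 (future_max_ge0 n k.+1 (Y ^~ w)).
    by rewrite addr0.
  have -> : (1 + K * b / B) = 1 + K / B * b by ring.
  lra.
- by move=> k /andP[_ kn]; have [_] := le_step_Lp p1 LpY kn.
- exact: future_max_end_moment.
Qed.

End DriftFree.

(** * Arbitrary expectations *)

Definition future_sum (f : R -> R) : nat -> nat -> (nat -> R) -> R :=
  tail_fold (fun x v => f x + v).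

Lemma future_sumE f n k z : (k <= n)%N ->
  future_sum f n k z = \sum_(k <= i < n) f (z i.+1).
Proof.
move: k; apply: down_ind => [|k kn ih]; first by rewrite /future_sum tail_fold_end big_geq.
by rewrite /future_sum tail_fold_step// [RHS]big_ltn// -ih.
Qed.

Lemma future_sum_future f n k : lLip1 f -> {homo f : x y / x <= y} ->
  (forall x, 0 <= f x) -> future_functional n k (future_sum f n k).
Proof.
move=> hf fm f0; apply: future_tail_fold => [m c d hc hd|x x' v v' xx' vv'|x v v0].
- by apply: C_lLipD => //; exact: C_lLip_comp1.
- by apply: lerD => //; exact: fm.
- exact: addr_ge0.
Qed.

Definition sumK (q : R) : R := q * 2 `^ q * 2 `^ q.

(** Rosenthal's inequality for nonnegative summands: the product rule applies
to [f (Y k)] and to the increasing function [(W + B) `^ (q - 1)] of the later sum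
[W]. A bound of this factor by [W `^ q] has to wait until the rule has been
applied, for [f (Y k) * W `^ q] need not be integrable. *)
Lemma nonneg_sum_moment (q : R) n (Y : nat -> T -> R) f : (0 < n)%N -> 1 <= q ->
  lLip1 f -> {homo f : x y / x <= y} -> (forall x, 0 <= f x) ->
  product_rule n Y -> (forall i, (1 <= i <= n)%N -> Lp q (fun w => f (Y i w))) ->
  Ex (fun w => (\sum_(0 <= k < n) f (Y k.+1 w)) `^ q) <=
  expR (sumK q) * sumK q *
    (\sum_(0 <= k < n) Ex (fun w => f (Y k.+1 w) `^ q) +
     (\sum_(0 <= k < n) Ex (fun w => f (Y k.+1 w))) `^ q).
Proof.
move=> n0 q1 hf fm f0 pr LpY; have q0 : 0 <= q by lra.
have two : 1 <= (2 : R) `^ q by apply: powR_ge1; lra.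
have K0 : 0 <= sumK q by rewrite /sumK !mulr_ge0// powR_ge0.
have hW k := future_sum_future n k hf fm f0.
have W0 k w := future_ge0 (hW k) (Y ^~ w).
have LpW k : (k <= n)%N -> Lp q (fun w => future_sum f n k (Y ^~ w)).
  move=> kn; under eq_fun do rewrite future_sumE//.
  apply: (Lp_sum q1 (Y := fun i w => f (Y i.+1 w))) => i.
  by rewrite mem_index_iota => /andP[_]; exact: (LpY i.+1).
have LW k : (k <= n)%N -> L1 (fun w => future_sum f n k (Y ^~ w) `^ q).
  by move=> kn; have := Lp_L1 (LpW k kn); rewrite norm_powR_fun.
have LY k : (k < n)%N -> L1 (fun w => f (Y k.+1 w) `^ q).
  by move=> kn; have := Lp_L1 (LpY k.+1 kn); rewrite norm_powR_fun.
have LfY k (kn : (k < n)%N) : L1 (fun w => f (Y k.+1 w)) by exact: (Lp_id q1 (LpY k.+1 kn)).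
have -> : (fun w => (\sum_(0 <= k < n) f (Y k.+1 w)) `^ q) =
    (fun w => future_sum f n 0 (Y ^~ w) `^ q).
  by apply/funext => w; rewrite future_sumE.
pose v k := Ex (fun w => future_sum f n k (Y ^~ w) `^ q).
apply: (@backward_gronwall_scaled R n v v) => //.
- by move=> k kn; apply: Ex_ge0 (LfY k kn) _ => w.
- by move=> k kn; apply: Ex_ge0 (LY k kn) _ => w; exact: powR_ge0.
- move=> B k B0 kn.
  have q10 : 0 <= q - 1 by lra.
  have q1q : q - 1 <= q by lra.
  have LWB := shift_powR_L1 q1 (ltW B0) q10 q1q (or_introl B0) (LpW k.+1 kn) (W0 k.+1).
  have LYW := L1_young q1 (ltW B0) (LpY k.+1 kn) (LpW k.+1 kn) (W0 k.+1) (L1_rvs LWB).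
  set b := Ex (fun w => f (Y k.+1 w)); set c := Ex (fun w => f (Y k.+1 w) `^ q).
  have b0 : 0 <= b by apply: Ex_ge0 (LfY k kn) _ => w.
  have c0 : 0 <= c by apply: Ex_ge0 (LY k kn) _ => w; exact: powR_ge0.
  have EYW := pr k.+1 _ f b kn (future_powR (ltW B0) q10 (or_introl B0) (hW k.+1))
    hf fm b0 (LfY k kn) (lexx _) LWB LYW.
  have hk : 0 <= q * 2 `^ q by rewrite mulr_ge0// powR_ge0.
  have L := L1D LYW (LY k kn).
  have h1 : v k <= v k.+1 +
      Ex (fun w => (q * 2 `^ q) * (f (Y k.+1 w) * (future_sum f n k.+1 (Y ^~ w) + B) `^ (q - 1)
        + f (Y k.+1 w) `^ q)).
    apply: (Ex_leD2 (LW k (ltnW kn)) (LW k.+1 kn) (L1Z _ L)) => w.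
    rewrite [in leLHS]/future_sum tail_fold_step// -/(future_sum f n k.+1 _).
    exact: powRD_split.
  rewrite (ExZ hk L) in h1.
  have h2 := ExD LYW (LY k kn).
  have h3 : Ex (fun w => (future_sum f n k.+1 (Y ^~ w) + B) `^ (q - 1)) <=
      2 `^ q * (v k.+1 / B + B `^ (q - 1)).
    have LWs := L1D (L1Z B^-1 (LW k.+1 kn)) (L1_cst (B `^ (q - 1))).
    apply: (@le_trans _ _ (Ex (fun w => 2 `^ q * (B^-1 * future_sum f n k.+1 (Y ^~ w) `^ q + B `^ (q - 1))))).
      apply: (Ex_le LWB (L1Z _ LWs)) => w.
      by rewrite [B^-1 * _]mulrC; exact: powR_shift_le_scaled.
    rewrite (ExZ (powR_ge0 _ _) LWs) ler_wpM2l ?powR_ge0//.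
    rewrite (Ex_addc _ (L1Z B^-1 (LW k.+1 kn))) ExZ ?invr_ge0 ?(ltW B0)//; last exact: LW.
    by rewrite -/(v k.+1) mulrC.
  have h4 := ler_wpM2l b0 h3.
  have h5 := ler_wpM2l hk (le_trans h2 (lerD (le_trans EYW h4) (lexx _))).
  rewrite -/c in h5.
  have h6 : q * 2 `^ q * c <= sumK q * c.
    by rewrite ler_wpM2r// /sumK ler_peMr.
  apply: le_trans h1 _; rewrite -!addrA mulrDl mul1r -addrA lerD2l.
  apply: le_trans h5 _.
  have -> : q * 2 `^ q * (b * (2 `^ q * (v k.+1 / B + B `^ (q - 1))) + c) =
     sumK q * b / B * v k.+1 + q * 2 `^ q * c + sumK q * b * B `^ (q - 1).
    by rewrite /sumK; ring.
  lra.
- have q00 : q != 0 by lra.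
  rewrite /v; under eq_fun do rewrite future_sumE// big_geq// powR0//.
  by rewrite Ex_cst.
Qed.

Lemma Lp_half_sqr (p : R) X : 2 <= p -> Lp p X -> Lp (p / 2) (fun w => X w ^+ 2).
Proof.
move=> p2 hX; split; first by case: (Lp_sqr p2 hX).
have := Lp_L1 hX; congr (L1 _); apply/funext => w.
by rewrite (ger0_norm (sqr_ge0 _)) sqr_powR_half.
Qed.

Section SquareFunction.
Variables (p : R) (n : nat) (Y : nat -> T -> R).

(** The increments of [V k `^ p] are summed before expectations are taken: the
square of the negative part of [Y k] decreases in [Y k], so that negative
dependence gives no bound of its product with [V k `^ (p - 2)]. Instead all the
[V k] are replaced by a common upper bound [N] in the quadratic terms, which
leaves the square function. *)
Lemma future_max_moment_drift (a : nat -> R) (N : T -> R) (e : R) : (0 < n)%N -> 2 <= p ->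
  product_rule n Y -> (forall i, (1 <= i <= n)%N -> Lp p (Y i)) ->
  (forall k, (k < n)%N -> 0 <= a k /\ Ex (Y k.+1) <= a k) ->
  Lp p N -> (forall w, 0 <= N w) ->
  (forall k w, (k <= n)%N -> future_max n k (Y ^~ w) <= N w) -> 0 < e ->
  Ex (fun w => future_max n 0 (Y ^~ w) `^ p) <=
   taylorK p * \sum_(0 <= k < n) Ex (fun w => `|Y k.+1 w| `^ p) +
   taylorK p * e `^ (- (p / 2 - 1)) *
     Ex (fun w => (\sum_(0 <= k < n) Y k.+1 w ^+ 2) `^ (p / 2)) +
   p * e `^ (- (p - 1)) * (\sum_(0 <= k < n) a k) `^ p +
   (p + taylorK p) * e * Ex (fun w => N w `^ p).
Proof.
move=> n0 p2 pr LpY ha LpN N0 VN e0.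
have p1 : 1 <= p by lra. have p0 : 0 <= p by lra.
have K1 := taylorK_ge1 p; have K0 : 0 <= taylorK p by lra.
pose Q w := \sum_(0 <= k < n) Y k.+1 w ^+ 2.
have Q0 w : 0 <= Q w by apply: sumr_ge0 => i _; exact: sqr_ge0.
have LY k (kn : (k < n)%N) := Lp_L1 (LpY k.+1 kn).
have iota_lt k : k \in index_iota 0 n -> (k < n)%N by rewrite mem_index_iota.
have LQ : L1 (fun w => Q w `^ (p / 2)).
  have ph : 1 <= p / 2 by lra.
  have := Lp_L1 (Lp_sum ph (s := index_iota 0 n) (Y := fun k w => Y k.+1 w ^+ 2) _).
  rewrite norm_powR_fun//; apply => k /iota_lt kn; exact: Lp_half_sqr p2 (LpY k.+1 kn).
have LN : L1 (fun w => N w `^ p) by have := Lp_L1 LpN; rewrite norm_powR_fun.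
have r0 : 0 <= p - 1 by lra.
have r1 : p - 1 <= p by lra.
have LN1 := shift_powR_L1 p1 (lexx 0) r0 r1 (or_intror (_ : 1 <= p - 1)) LpN N0.
have {}LN1 : L1 (fun w => (N w + 0) `^ (p - 1)) by apply: LN1; lra.
have V0 k w := future_max_ge0 n k (Y ^~ w).
pose lin k w := Y k.+1 w * (future_max n k.+1 (Y ^~ w) + 0) `^ (p - 1).
have tele k : (k <= n)%N -> forall w, future_max n k (Y ^~ w) `^ p <=
   \sum_(k <= i < n) (p * lin i w + taylorK p * `|Y i.+1 w| `^ p +
     taylorK p * (Y i.+1 w ^+ 2 * N w `^ (p - 2))).
  move: k; apply: down_ind => [w|k kn ih w].
    by rewrite big_geq// future_max_end powR0//; lra.
  rewrite big_ltn//.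
  apply: le_trans (ler_powR_base p0 (V0 k w) (future_max_le _ kn)) _.
  apply: le_trans (powR_normD_ge2 _ p2 (V0 k.+1 w)) _.
  have h1 := ih w.
  have h2 : future_max n k.+1 (Y ^~ w) `^ (p - 2) <= N w `^ (p - 2).
    by apply: ler_powR_base; [lra|exact: V0|exact: VN].
  have h3 := ler_wpM2l K0 (ler_wpM2l (sqr_ge0 (Y k.+1 w)) h2).
  rewrite /lin addr0; lra.
have tele0 w : future_max n 0 (Y ^~ w) `^ p <=
    \sum_(0 <= i < n) (p * lin i w + taylorK p * `|Y i.+1 w| `^ p) +
    (taylorK p * e * N w `^ p + taylorK p * e `^ (- (p / 2 - 1)) * Q w `^ (p / 2)).
  apply: le_trans (tele 0 isT w) _; rewrite big_split/= lerD2l -mulr_sumr -mulr_suml -/(Q w).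
  have := young_split (Q0 w) (N0 w) e0 (ltr0n _ 2) p2.
  have -> : (p - 2) / 2 = p / 2 - 1 by field.
  by move=> /(ler_wpM2l K0); rewrite mulrDr !mulrA.
have linP k (kn : (k < n)%N) := linear_term p1 (lexx 0) (or_intror p2) LpY kn pr (ha k kn).1 (ha k kn).2.
have LV0 := future_max_L1 p1 LpY (leq0n n).
have LS : L1 (fun w => \sum_(0 <= i < n) (p * lin i w + taylorK p * `|Y i.+1 w| `^ p)).
  apply: L1_sum => k /iota_lt kn; have [_ Ll _] := linP k kn.
  exact: (L1D (L1Z p Ll) (L1Z _ (LY k kn))).
have c1 : 0 <= taylorK p * e by rewrite mulr_ge0// ltW.
have c2 : 0 <= taylorK p * e `^ (- (p / 2 - 1)) by rewrite mulr_ge0// powR_ge0.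
have L2 := L1D (L1Z (taylorK p * e) LN) (L1Z (taylorK p * e `^ (- (p / 2 - 1))) LQ).
have h1 := Ex_leD2 LV0 LS L2 tele0.
have h2 := ExD (L1Z (taylorK p * e) LN) (L1Z (taylorK p * e `^ (- (p / 2 - 1))) LQ).
rewrite (ExZ c1 LN) (ExZ c2 LQ) in h2.
have A0 : 0 <= \sum_(0 <= k < n) a k.
  by rewrite big_nat sumr_ge0// => k kn; have [] := ha k kn.
have h3 : Ex (fun w => \sum_(0 <= i < n) (p * lin i w + taylorK p * `|Y i.+1 w| `^ p)) <=
   p * (\sum_(0 <= k < n) a k * Ex (fun w => (N w + 0) `^ (p - 1))) +
   taylorK p * \sum_(0 <= k < n) Ex (fun w => `|Y k.+1 w| `^ p).
  apply: le_trans (Ex_sum (Y := fun i w => p * lin i w + taylorK p * `|Y i.+1 w| `^ p) _) _.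
    move=> k /iota_lt kn; have [_ Ll _] := linP k kn.
    exact: (L1D (L1Z p Ll) (L1Z _ (LY k kn))).
  rewrite !mulr_sumr -big_split/= big_nat [leRHS]big_nat; apply: ler_sum => k kn.
  have [LVp Ll El] := linP k kn; have [a0 _] := ha k kn.
  apply: le_trans (ExD (L1Z p Ll) (L1Z _ (LY k kn))) _.
  rewrite (ExZ p0 Ll) (ExZ K0 (LY k kn)) lerD2r ler_wpM2l//.
  apply: le_trans El _; rewrite ler_wpM2l//; apply: (Ex_le LVp LN1) => w.
  by apply: ler_powR_base; rewrite ?addr0 ?V0 ?VN//; lra.
have h4 : (\sum_(0 <= k < n) a k) * Ex (fun w => (N w + 0) `^ (p - 1)) <=
    e * Ex (fun w => N w `^ p) + e `^ (- (p - 1)) * (\sum_(0 <= k < n) a k) `^ p.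
  rewrite -(ExZ A0 LN1) -(ExZ (ltW e0) LN).
  rewrite -[X in _ <= _ + X](Ex_cst (e `^ (- (p - 1)) * (\sum_(0 <= k < n) a k) `^ p)).
  apply: (Ex_leD2 (L1Z _ LN1) (L1Z e LN) (L1_cst _)) => w.
  by have := young_split A0 (N0 w) e0 ltr01 p1; rewrite !divr1 addr0.
rewrite -mulr_suml in h3.
have h5 := ler_wpM2l p0 h4.
apply: le_trans h1 _; apply: le_trans (lerD h3 h2) _.
lra.
Qed.

(** The squares of the positive parts are increasing in [Y], those of the
negative parts in [- Y]; each family falls under [nonneg_sum_moment]. *)
Lemma square_function_moment : (0 < n)%N -> 2 <= p ->
  product_rule n Y -> product_rule n (fun i w => - Y i w) ->
  (forall i, (1 <= i <= n)%N -> Lp p (Y i)) ->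
  Ex (fun w => (\sum_(0 <= k < n) Y k.+1 w ^+ 2) `^ (p / 2)) <=
  2 `^ (p / 2) * (2 * (expR (sumK (p / 2)) * sumK (p / 2))) *
    (\sum_(0 <= k < n) Ex (fun w => `|Y k.+1 w| `^ p) +
     (\sum_(0 <= k < n) Ex (fun w => Y k.+1 w ^+ 2)) `^ (p / 2)).
Proof.
move=> n0 p2 pr prN LpY; have q1 : 1 <= p / 2 by lra.
have p0 : 0 <= p by lra. have q0 : 0 <= p / 2 by lra.
have p1 : 1 <= p by lra.
have iota_lt k : k \in index_iota 0 n -> (k < n)%N by rewrite mem_index_iota.
pose f (x : R) := Num.max 0 x ^+ 2.
have f0 x : 0 <= f x by exact: sqr_ge0.
have mx0 x : 0 <= Num.max 0 x :> R by rewrite le_max lexx.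
have fm : {homo f : x y / x <= y}.
  move=> x y xy; rewrite /f lerXn2r ?nnegrE//.
  by rewrite ge_max le_max lexx /= le_max xy orbT.
have hf : lLip1 f by apply: C_lLipM; exact: lLip1_maxr0.
have fle x : f x <= x ^+ 2.
  by rewrite /f; case: (lerP 0 x) => _ //; rewrite expr0n/= sqr_ge0.
have fpm x : x ^+ 2 = f x + f (- x).
  rewrite /f; case: (lerP 0 x) => hx; case: (lerP 0 (- x)) => hx'; try (ring; lra).
    have -> : x = 0 by lra.
    by rewrite oppr0 expr0n/= addr0.
  lra.
have fq x : f x `^ (p / 2) <= `|x| `^ p.
  by rewrite -sqr_powR_half; apply: ler_powR_base.
have D0 : 0 <= expR (sumK (p / 2)) * sumK (p / 2).
  by rewrite /sumK !mulr_ge0 ?expR_ge0 ?powR_ge0.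
have half (Z : nat -> T -> R) : product_rule n Z ->
    (forall i w, `|Z i w| = `|Y i w|) -> (forall i, (1 <= i <= n)%N -> Lp p (Z i)) ->
    L1 (fun w => (\sum_(0 <= k < n) f (Z k.+1 w)) `^ (p / 2)) /\
    Ex (fun w => (\sum_(0 <= k < n) f (Z k.+1 w)) `^ (p / 2)) <=
    expR (sumK (p / 2)) * sumK (p / 2) *
    (\sum_(0 <= k < n) Ex (fun w => `|Y k.+1 w| `^ p) +
     (\sum_(0 <= k < n) Ex (fun w => Y k.+1 w ^+ 2)) `^ (p / 2)).
  move=> prZ ZY LpZ.
  have LpfZ i : (1 <= i <= n)%N -> Lp (p / 2) (fun w => f (Z i w)).
    move=> ni; apply: (Lp_le q1 _ (Lp_half_sqr p2 (LpZ i ni))).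
      exact: rvs_comp1 hf (Lp_rvs (LpZ i ni)).
    by move=> w; rewrite !ger0_norm ?sqr_ge0.
  have sum0 w : 0 <= \sum_(0 <= k < n) f (Z k.+1 w) by exact: sumr_ge0.
  split.
    have := Lp_L1 (Lp_sum q1 (s := index_iota 0 n) (Y := fun k w => f (Z k.+1 w)) _).
    by rewrite norm_powR_fun//; apply => k /iota_lt kn; exact: (LpfZ k.+1).
  apply: le_trans (nonneg_sum_moment n0 q1 hf fm f0 prZ LpfZ) _.
  have sqZ i w : Z i w ^+ 2 = Y i w ^+ 2.
    by rewrite -(real_normK (num_real (Z i w))) ZY real_normK ?num_real.
  rewrite ler_wpM2l//; apply: lerD.
    rewrite big_nat [leRHS]big_nat; apply: ler_sum => k kn.
    have L := Lp_L1 (LpfZ k.+1 kn); rewrite norm_powR_fun// in L.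
    by apply: (Ex_le L (Lp_L1 (LpY k.+1 kn))) => w; rewrite -ZY.
  apply: ler_powR_base => //.
    rewrite big_nat sumr_ge0// => k kn.
    exact: (Ex_ge0 (Lp_id q1 (LpfZ k.+1 kn))).
  rewrite big_nat [leRHS]big_nat; apply: ler_sum => k kn.
  by apply: (Ex_le (Lp_id q1 (LpfZ k.+1 kn)) (Lp_sqr p2 (LpY k.+1 kn))) => w; rewrite -sqZ.
have LpN i (ni : (1 <= i <= n)%N) : Lp p (fun w => - Y i w) by exact: LpN (LpY i ni).
have [L1p E1p] := half Y pr (fun i w => erefl) LpY.
have [L1n E1n] := half _ prN (fun i w => normrN (Y i w)) LpN.
have two0 : 0 <= (2 : R) `^ (p / 2) by exact: powR_ge0.
have LS := L1D L1p L1n.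
apply: (@le_trans _ _ (Ex (fun w => 2 `^ (p / 2) * ((\sum_(0 <= k < n) f (Y k.+1 w)) `^ (p / 2) +
    (\sum_(0 <= k < n) f (- Y k.+1 w)) `^ (p / 2))))).
  have LQ : L1 (fun w => (\sum_(0 <= k < n) Y k.+1 w ^+ 2) `^ (p / 2)).
    have := Lp_L1 (Lp_sum q1 (s := index_iota 0 n) (Y := fun k w => Y k.+1 w ^+ 2) _).
    rewrite norm_powR_fun => [|w]; last by apply: sumr_ge0 => i _; exact: sqr_ge0.
    by apply => k /iota_lt kn; exact: Lp_half_sqr p2 (LpY k.+1 kn).
  apply: (Ex_le LQ (L1Z _ LS)) => w.
  under eq_bigr do rewrite fpm.
  by rewrite big_split/=; apply: powRD_le => //; exact: sumr_ge0.
rewrite (ExZ two0 LS) -mulrA ler_wpM2l//.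
apply: le_trans (ExD L1p L1n) _; lra.
Qed.

End SquareFunction.

(** For [2 <= p] one has [(p + taylorK p) * absorb_eps p * 2 `^ p <= 4^-1]: the bounds for
[Y] and for [- Y] then return at most half of the moment to be estimated. *)
Definition absorb_eps (p : R) : R := (8 * taylorK p * 2 `^ p)^-1.

Definition drift_const (p : R) : R :=
  4 * (taylorK p
   + taylorK p * absorb_eps p `^ (- (p / 2 - 1)) *
       (2 `^ (p / 2) * (2 * (expR (sumK (p / 2)) * sumK (p / 2))))
   + p * absorb_eps p `^ (- (p - 1))).

Lemma max_abs_psum_Lp (p : R) n (Y : nat -> T -> R) : 1 <= p -> (0 < n)%N ->
  (forall i, (1 <= i <= n)%N -> Lp p (Y i)) -> Lp p (max_abs_psum Y n).
Proof.
move=> p1 n0 LpY.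
have HM : H (max_abs_psum Y n).
  have Hps k : (k <= n)%N -> H (psum Y k).
    move=> kn; apply: rvs_sum => i; rewrite mem_index_iota ltnS => /andP[i1 ik].
    by apply: Lp_rvs (LpY i _); rewrite i1 (leq_trans ik kn).
  apply: (rvs_bigmax (Y := fun k w => `|psum Y k w|)).
    by apply: rvs_norm; exact: Hps.
  by move=> k; rewrite mem_index_iota ltnS => /andP[_ kn]; apply: rvs_norm; exact: Hps.
apply: (Lp_le p1 HM (Lp_sum p1 (s := index_iota 1 n.+1) (Y := fun i w => `|Y i w|) _)).
  by move=> i; rewrite mem_index_iota ltnS => ni; have := Lp_norm p1 (LpY i ni).
move=> w; rewrite (ger0_norm (max_abs_psum_ge0 Y w n)).
by rewrite ger0_norm ?sumr_ge0//; exact: max_abs_psum_le_sum.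
Qed.

(** The moment of [max_abs_psum] is at most the sum of those of [future_max] for
[Y] and for [- Y], which are bounded in terms of itself with a small factor. *)
Lemma max_abs_moment (p : R) n (Y : nat -> T -> R) : (0 < n)%N -> 2 <= p ->
  product_rule n Y -> product_rule n (fun i w => - Y i w) ->
  (forall i, (1 <= i <= n)%N -> Lp p (Y i)) ->
  Ex (fun w => max_abs_psum Y n w `^ p) <=
  drift_const p *
    (\sum_(0 <= k < n) Ex (fun w => `|Y k.+1 w| `^ p) +
     (\sum_(0 <= k < n) Ex (fun w => Y k.+1 w ^+ 2)) `^ (p / 2) +
     (\sum_(0 <= k < n)
        (Num.max (Ex (fun w => - Y k.+1 w)) 0 + Num.max (Ex (Y k.+1)) 0)) `^ p).
Proof.
move=> n0 p2 pr prN LpY; have p1 : 1 <= p by lra. have p0 : 0 <= p by lra.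
have K1 := taylorK_ge1 p; have K0 : 0 <= taylorK p by lra.
have two : 1 <= (2 : R) `^ p by apply: powR_ge1; lra.
have LpN i (ni : (1 <= i <= n)%N) : Lp p (fun w => - Y i w) by exact: LpN (LpY i ni).
have M0 w := max_abs_psum_ge0 Y w n.
have LpM := max_abs_psum_Lp p1 n0 LpY.
have LM : L1 (fun w => max_abs_psum Y n w `^ p).
  by have := Lp_L1 LpM; rewrite norm_powR_fun.
pose N w := 2 * max_abs_psum Y n w.
have N0 w : 0 <= N w by rewrite /N mulr_ge0.
have LpNN : Lp p N.
  have := LpD p1 LpM LpM; congr (Lp p _); apply/funext => w; rewrite /N; ring.
have EN : Ex (fun w => N w `^ p) = 2 `^ p * Ex (fun w => max_abs_psum Y n w `^ p).
  rewrite -ExZ ?powR_ge0//; congr (Ex _); apply/funext => w.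
  by rewrite /N powRM.
have MN w : max_abs_psum (fun i w => - Y i w) n w = max_abs_psum Y n w.
  rewrite /max_abs_psum psumN normrN; apply: eq_bigr => k _.
  by rewrite psumN normrN.
set e := absorb_eps p.
have e0 : 0 < e by rewrite /e /absorb_eps invr_gt0 !mulr_gt0//; lra.
set A := \sum_(0 <= k < n) (_ + _).
set P := \sum_(0 <= k < n) Ex (fun w => `|Y k.+1 w| `^ p).
set S := (\sum_(0 <= k < n) Ex (fun w => Y k.+1 w ^+ 2)) `^ (p / 2).
set EQ := Ex (fun w => (\sum_(0 <= k < n) Y k.+1 w ^+ 2) `^ (p / 2)).
have mx0 (x : R) : 0 <= Num.max x 0 by rewrite le_max lexx orbT.
have half (Z : nat -> T -> R) (a : nat -> R) : product_rule n Z ->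
    (forall i w, `|Z i w| = `|Y i w|) -> (forall i, (1 <= i <= n)%N -> Lp p (Z i)) ->
    (forall k, (k < n)%N -> 0 <= a k /\ Ex (Z k.+1) <= a k) ->
    \sum_(0 <= k < n) a k <= A ->
    (forall w, max_abs_psum Z n w = max_abs_psum Y n w) ->
    Ex (fun w => future_max n 0 (Z ^~ w) `^ p) <=
    taylorK p * P + taylorK p * e `^ (- (p / 2 - 1)) * EQ +
    p * e `^ (- (p - 1)) * A `^ p + 4^-1 * Ex (fun w => max_abs_psum Y n w `^ p).
  move=> prZ ZY LpZ ha aA ZM.
  have VN k w : (k <= n)%N -> future_max n k (Z ^~ w) <= N w.
    by move=> kn; rewrite /N -ZM; exact: future_max_le_max_abs.
  have := future_max_moment_drift n0 p2 prZ LpZ ha LpNN N0 VN e0.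
  have -> : (fun w => (\sum_(0 <= k < n) Z k.+1 w ^+ 2) `^ (p / 2)) =
     (fun w => (\sum_(0 <= k < n) Y k.+1 w ^+ 2) `^ (p / 2)).
    apply/funext => w; congr (_ `^ _); apply: eq_bigr => k _.
    by rewrite -(real_normK (num_real (Z _ _))) ZY real_normK ?num_real.
  have -> : \sum_(0 <= k < n) Ex (fun w => `|Z k.+1 w| `^ p) = P.
    apply: eq_bigr => k _; congr (Ex _); apply/funext => w; by rewrite ZY.
  rewrite -/EQ EN => h; apply: le_trans h _.
  have a0 : 0 <= \sum_(0 <= k < n) a k.
    by rewrite big_nat sumr_ge0// => k kn; have [] := ha k kn.
  apply: lerD.
    by rewrite lerD2l ler_wpM2l ?mulr_ge0 ?powR_ge0//; exact: ler_powR_base.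
  rewrite mulrA ler_wpM2r//; first by apply: Ex_ge0 => // w; exact: powR_ge0.
  have Kp := taylorK_ge p2.
  have -> : 4^-1 = 2 * taylorK p * e * 2 `^ p.
    by rewrite /e /absorb_eps; field; apply/andP; split; lra.
  by rewrite ler_wpM2r ?powR_ge0// ler_wpM2r ?(ltW e0)//; lra.
have le1 (x : R) : x <= Num.max x 0 by rewrite le_max lexx.
have hA1 : \sum_(0 <= k < n) Num.max (Ex (Y k.+1)) 0 <= A.
  by apply: ler_sum => k _; rewrite lerDr.
have hA2 : \sum_(0 <= k < n) Num.max (Ex (fun w => - Y k.+1 w)) 0 <= A.
  by apply: ler_sum => k _; rewrite lerDl.
have h1 := half Y (fun k => Num.max (Ex (Y k.+1)) 0) pr (fun _ _ => erefl) LpY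
  (fun _ _ => conj (mx0 _) (le1 _)) hA1 (fun _ => erefl).
have h2 := half (fun i w => - Y i w) (fun k => Num.max (Ex (fun w => - Y k.+1 w)) 0) prN
  (fun i w => normrN (Y i w)) LpN (fun _ _ => conj (mx0 _) (le1 _)) hA2 MN.
have LV1 := future_max_L1 p1 LpY (leq0n n).
have LV2 := future_max_L1 p1 LpN (leq0n n).
have h3 : Ex (fun w => max_abs_psum Y n w `^ p) <=
   Ex (fun w => future_max n 0 (Y ^~ w) `^ p) +
   Ex (fun w => future_max n 0 (fun i => - Y i w) `^ p).
  apply: (Ex_leD2 LM LV1 LV2) => w.
  apply: le_trans (ler_powR_base p0 (M0 w) (max_abs_psum_le Y w n0)) _.
  set x := future_max n 0 _; set y := future_max n 0 _.
  have := powR_ge0 x p; have := powR_ge0 y p.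
  by rewrite /Num.max; case: ifP => _; lra.
have h4 := square_function_moment n0 p2 pr prN LpY.
rewrite -/EQ -/P -/S in h4.
have c1 : 0 <= taylorK p * e `^ (- (p / 2 - 1)) by rewrite mulr_ge0// powR_ge0.
have h5 := ler_wpM2l c1 h4.
have P0 : 0 <= P := sum_moments_ge0 LpY.
have S0 : 0 <= S by exact: powR_ge0.
have Ap0 : 0 <= A `^ p by exact: powR_ge0.
rewrite /drift_const -/e.
set D := 2 `^ (p / 2) * _ in h4 h5 *.
have D0 : 0 <= D.
  by rewrite /D /sumK !mulr_ge0 ?expR_ge0 ?powR_ge0//; lra.
set c := taylorK p * e `^ _ in c1 h1 h2 h5 *.
set c' := p * e `^ _ in h1 h2 *.
have c'0 : 0 <= c' by rewrite mulr_ge0// powR_ge0.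
have cD : 0 <= c * D by exact: mulr_ge0.
have t1 : 0 <= taylorK p * S by exact: mulr_ge0.
have t2 : 0 <= taylorK p * A `^ p by exact: mulr_ge0.
have t3 : 0 <= c * D * A `^ p by exact: mulr_ge0.
have t4 : 0 <= c' * P by exact: mulr_ge0.
have t5 : 0 <= c' * S by exact: mulr_ge0.
lra.
Qed.

(** * Reversal of the order of the variables *)

Lemma neg_dep_transport m k (X X' : 'I_m -> T -> R) (Z Z' : 'I_k -> T -> R)
    (s : 'rV[R]_m -> 'rV[R]_m) (t : 'rV[R]_k -> 'rV[R]_k) :
  (forall w, s (rvec X w) = rvec X' w) -> (forall w, t (rvec Z w) = rvec Z' w) ->
  (forall phi, C_lLip phi -> C_lLip (phi \o s)) ->
  (forall phi, C_lLip phi -> C_lLip (phi \o t)) ->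
  (forall phi1 phi2,
    (coord_nondecreasing phi1 /\ coord_nondecreasing phi2) \/
    (coord_nonincreasing phi1 /\ coord_nonincreasing phi2) ->
    (coord_nondecreasing (phi1 \o s) /\ coord_nondecreasing (phi2 \o t)) \/
    (coord_nonincreasing (phi1 \o s) /\ coord_nonincreasing (phi2 \o t))) ->
  neg_dep_to E Z X -> neg_dep_to E Z' X'.
Proof.
move=> sX tZ Cs Ct mono nd phi1 phi2 C1 C2.
have -> : rvec X' = s \o rvec X by apply/funext => w; rewrite /= sX.
have -> : rvec Z' = t \o rvec Z by apply/funext => w; rewrite /= tZ.
move=> pos E2 F12 F1 F2 m12.
exact: (nd (phi1 \o s) (phi2 \o t) (Cs _ C1) (Ct _ C2) pos E2 F12 F1 F2 (mono _ _ m12)).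
Qed.

Lemma neg_dep_opp m k (X : 'I_m -> T -> R) (Z : 'I_k -> T -> R) :
  neg_dep_to E Z X -> neg_dep_to E (fun i w => - Z i w) (fun i w => - X i w).
Proof.
pose opp l (x : 'rV[R]_l) : 'rV[R]_l := \row_i - x 0 i.
have opp_rvec l (W : 'I_l -> T -> R) w : opp l (rvec W w) = rvec (fun i w => - W i w) w.
  by apply/rowP => i; rewrite !mxE.
have C_opp l (phi : 'rV[R]_l -> R) : C_lLip phi -> C_lLip (phi \o opp l).
  move=> Cphi; apply: (C_lLip_comp (c := fun i x => - x 0 i)) => // i.
  have -> : (fun x : 'rV[R]_l => - x 0 i) = (fun x => -1 * x 0 i).
    by apply/funext => x; rewrite mulN1r.
  exact: C_lLipM (C_lLip_cst l (-1)) (C_lLip_coord i).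
have opp_nd l (phi : 'rV[R]_l -> R) :
    coord_nondecreasing phi -> coord_nonincreasing (phi \o opp l).
  move=> mphi i x y xy xyi; apply: (mphi i) => [j ji|]; rewrite !mxE ?lerN2//.
  by rewrite xy.
have opp_ni l (phi : 'rV[R]_l -> R) :
    coord_nonincreasing phi -> coord_nondecreasing (phi \o opp l).
  move=> mphi i x y xy xyi; apply: (mphi i) => [j ji|]; rewrite !mxE ?lerN2//.
  by rewrite xy.
apply: (neg_dep_transport (opp_rvec m X) (opp_rvec k Z) (C_opp m) (C_opp k)).
by move=> phi1 phi2 [] [h1 h2]; [right|left]; split;
  first [exact: opp_nd|exact: opp_ni].
Qed.

Definition reversed n (X : nat -> T -> R) : nat -> T -> R := fun j => X (n.+1 - j)%N.

Lemma neg_dep_reversed n (X : nat -> T -> R) k : (1 <= k < n)%N ->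
  neg_dep_to E (single X (n - k).+1) (initial X (n - k)) ->
  neg_dep_to E (single (reversed n X) k) (final (reversed n X) n k).
Proof.
move=> /andP[k1 kn].
pose rv (x : 'rV[R]_(n - k)) : 'rV[R]_(n - k) := \row_i x 0 (rev_ord i).
have C_rv (phi : 'rV[R]_(n - k) -> R) : C_lLip phi -> C_lLip (phi \o rv).
  move=> Cphi; apply: (C_lLip_comp (c := fun i x => x 0 (rev_ord i))) => // i.
  exact: C_lLip_coord.
have rv_nd (phi : 'rV[R]_(n - k) -> R) : coord_nondecreasing phi ->
    coord_nondecreasing (phi \o rv).
  move=> mphi i x y xy xyi; apply: (mphi (rev_ord i)) => [j ji|]; rewrite !mxE ?rev_ordK//.
  by apply: xy; apply: contraNneq ji => <-; rewrite rev_ordK.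
have rv_ni (phi : 'rV[R]_(n - k) -> R) : coord_nonincreasing phi ->
    coord_nonincreasing (phi \o rv).
  move=> mphi i x y xy xyi; apply: (mphi (rev_ord i)) => [j ji|]; rewrite !mxE ?rev_ordK//.
  by apply: xy; apply: contraNneq ji => <-; rewrite rev_ordK.
have rv_final w : rv (rvec (initial X (n - k)) w) = rvec (final (reversed n X) n k) w.
  apply/rowP => i; rewrite !mxE /initial /final /reversed /=.
  by congr (X _ w); have := ltn_ord i; lia.
have id_single w : id (rvec (single X (n - k).+1) w) = rvec (single (reversed n X) k) w.
  by apply/rowP => i; rewrite !mxE /single /reversed subSn// ltnW.
apply: (neg_dep_transport rv_final id_single C_rv (fun _ => id)).
by move=> phi1 phi2 [] [h1 h2]; [left|right]; split=> //;
  first [exact: rv_nd|exact: rv_ni].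
Qed.

Lemma psum_reversed n (X : nat -> T -> R) w k : (k <= n)%N ->
  psum (reversed n X) k w = psum X n w - psum X (n - k) w.
Proof.
elim: k => [|k ih] kn; first by rewrite psum0 subn0 subrr.
rewrite psumS ih ?(ltnW kn)// /reversed subSS.
by rewrite -(subnSK kn) psumS; ring.
Qed.

(** The partial sums of the reversed sequence are the sums
[X_(n-k+1) + ... + X_n], and a partial sum is a difference of two of them. *)
Lemma max_abs_psum_reversed n (X : nat -> T -> R) w : (0 < n)%N ->
  max_abs_psum X n w <= 2 * max_abs_psum (reversed n X) n w.
Proof.
move=> n0; have h j : (j <= n)%N -> `|psum X j w| <= 2 * max_abs_psum (reversed n X) n w.
  move=> jn; have nj : (n - j <= n)%N by rewrite leq_subr.
  have h1 := psum_le_max_abs0 (reversed n X) w (leqnn n).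
  have h2 := psum_le_max_abs0 (reversed n X) w nj.
  rewrite psum_reversed// subnn psum0 subr0 in h1.
  rewrite psum_reversed// subKn// distrC in h2.
  have -> : psum X j w = (psum X j w - psum X n w) + psum X n w by ring.
  by apply: le_trans (ler_normD _ _) _; lra.
rewrite {1}/max_abs_psum big_nat; apply: bigmax_le => [|j /andP[_ jn]]; exact: h.
Qed.

Lemma sum_reversed (G : (T -> R) -> R) n (X : nat -> T -> R) :
  \sum_(0 <= k < n) G (reversed n X k.+1) = \sum_(0 <= k < n) G (X k.+1).
Proof.
rewrite [RHS]big_nat_rev /= add0n big_nat [RHS]big_nat; apply: eq_bigr => k /andP[_ kn].
by rewrite /reversed subSS -(subnSK kn).
Qed.

Lemma max_abs_moment_reversed (p : R) n (X : nat -> T -> R) : (0 < n)%N -> 2 <= p ->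
  product_rule n (reversed n X) -> product_rule n (fun i w => - reversed n X i w) ->
  (forall i, (1 <= i <= n)%N -> Lp p (X i)) ->
  Ex (fun w => max_abs_psum X n w `^ p) <=
  2 `^ p * drift_const p *
    (\sum_(0 <= k < n) Ex (fun w => `|X k.+1 w| `^ p) +
     (\sum_(0 <= k < n) Ex (fun w => X k.+1 w ^+ 2)) `^ (p / 2) +
     (\sum_(0 <= k < n)
        (Num.max (Ex (fun w => - X k.+1 w)) 0 + Num.max (Ex (X k.+1)) 0)) `^ p).
Proof.
move=> n0 p2 pr prN LpX; have p1 : 1 <= p by lra.
have LpR i : (1 <= i <= n)%N -> Lp p (reversed n X i) by move=> ni; apply: LpX; lia.
have := max_abs_moment n0 p2 pr prN LpR.
rewrite (sum_reversed (fun Z => Ex (fun w => `|Z w| `^ p))).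
rewrite (sum_reversed (fun Z => Ex (fun w => Z w ^+ 2))).
rewrite (sum_reversed (fun Z => Num.max (Ex (fun w => - Z w)) 0 + Num.max (Ex Z) 0)).
move=> h; have := ler_wpM2l (powR_ge0 2 p) h; rewrite mulrA; apply: le_trans.
have M0 (Z : nat -> T -> R) w := max_abs_psum_ge0 Z w n.
have LM := Lp_L1 (max_abs_psum_Lp p1 n0 LpX); rewrite norm_powR_fun// in LM.
have LR := Lp_L1 (max_abs_psum_Lp p1 n0 LpR); rewrite norm_powR_fun// in LR.
rewrite -(ExZ (powR_ge0 2 p) LR); apply: (Ex_le LM (L1Z _ LR)) => w.
rewrite -powRM//; apply: ler_powR_base => //; first by lra.
exact: max_abs_psum_reversed.
Qed.

(** * Statements in extended reals *)

Section ExtendedReals.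
Variables (p : R) (n : nat) (X : nat -> T -> R).

(** In the first case the inequalities are trivial. *)
Lemma moments_dichotomy : 1 <= p -> (forall k, (1 <= k <= n)%N -> H (X k)) ->
  (\sum_(1 <= k < n.+1) E (fun w => `|X k w| `^ p)%R = +oo)%E \/
  (forall i, (1 <= i <= n)%N -> Lp p (X i)).
Proof.
move=> p1 HX.
have HXp k : (1 <= k <= n)%N -> H (fun w => `|X k w| `^ p).
  by move=> kn; exact: rvs_powR p1 (HX k kn).
have E0 k : (1 <= k < n.+1)%N -> (0 <= E (fun w => `|X k w| `^ p)%R)%E.
  by rewrite ltnS => kn; apply: expect_ge0 (HXp k kn) _ => w; exact: powR_ge0.
have [h|h] := pselect (forall i, (1 <= i <= n)%N -> (E (fun w => `|X i w| `^ p)%R < +oo)%E).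
  right=> i ni; split; first exact: HX.
  by apply: L1_fin (HXp i ni) _ (h i ni) => w; exact: powR_ge0.
left; rewrite big_nat; apply/esum_eqyP => [i ni|].
  by rewrite gt_eqF// (lt_le_trans (ltNyr 0))// E0.
have [i [ni Ei]] : exists i, (1 <= i <= n)%N /\ E (fun w => `|X i w| `^ p) = +oo%E.
  apply: contrapT => hn; apply: h => i ni; rewrite ltey; apply/eqP => Ei.
  by apply: hn; exists i.
by exists i; split; rewrite // mem_index_iota ltnS.
Qed.

Lemma sum_expect (f : R -> R) :
  (forall i, (1 <= i <= n)%N -> L1 (fun w => f (X i w))) ->
  (\sum_(1 <= k < n.+1) E (fun w => f (X k w)) =
   (\sum_(0 <= k < n) Ex (fun w => f (X k.+1 w)))%:E)%E.
Proof.
move=> LX; rewrite big_add1/= -sumEFin big_nat [RHS]big_nat.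
by apply: eq_bigr => k kn; rewrite expect_fin//; exact: LX.
Qed.

Lemma sum_expect_sqr : 2 <= p -> (forall i, (1 <= i <= n)%N -> Lp p (X i)) ->
  (\sum_(1 <= k < n.+1) E (fun w => `|X k w| ^+ 2)%R =
   (\sum_(0 <= k < n) Ex (fun w => X k.+1 w ^+ 2))%:E)%E.
Proof.
move=> p2 LpX; rewrite -(sum_expect (f := fun x => x ^+ 2)) => [|i ni].
  apply: eq_bigr => k _; congr (E _); apply/funext => w.
  by rewrite real_normK// num_real.
exact: Lp_sqr p2 (LpX i ni).
Qed.

Lemma sum_drift : (forall i, (1 <= i <= n)%N -> L1 (X i)) ->
  (\sum_(1 <= k < n.+1)
     (maxe (- conj_expectation E (X k)) 0 + maxe (E (X k)) 0) =
   (\sum_(0 <= k < n)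
     (Num.max (Ex (fun w => - X k.+1 w)) 0 + Num.max (Ex (X k.+1)) 0))%:E)%E.
Proof.
move=> LX; rewrite big_add1/= -sumEFin big_nat [RHS]big_nat.
apply: eq_bigr => k kn; have Lk := LX k.+1 kn.
by rewrite /conj_expectation oppeK (expect_fin Lk) (expect_fin (L1N Lk)) -!EFin_max.
Qed.

End ExtendedReals.

(** The absolute value and the summand [1] only make it positive for all [p]. *)
Definition rosenthal_const (p : R) : R :=
  1 + expR 1 * (2 * taylorK p `^ (p / 2)) + expR (taylorK p) * taylorK p
  + (2 `^ p) * `|drift_const p|.

Lemma rosenthal_const_ge (p : R) : 0 <= p ->
  [/\ expR 1 * (2 * taylorK p `^ (p / 2)) <= rosenthal_const p,
  expR (taylorK p) * taylorK p <= rosenthal_const p,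
  drift_const p <= rosenthal_const p &
  2 `^ p * drift_const p <= rosenthal_const p].
Proof.
move=> p0.
have a0 : 0 <= expR 1 * (2 * taylorK p `^ (p / 2)).
  by rewrite !mulr_ge0 ?expR_ge0 ?powR_ge0.
have b0 : 0 <= expR (taylorK p) * taylorK p.
  by rewrite mulr_ge0 ?expR_ge0// (le_trans ler01)// taylorK_ge1.
have t0 := powR_ge0 (2 : R) p; have d0 := normr_ge0 (drift_const p).
have h := ler_norm (drift_const p).
have c0 := mulr_ge0 t0 d0.
have hc := ler_wpM2l t0 h.
have two : 1 <= (2 : R) `^ p by apply: powR_ge1; lra.
have : `|drift_const p| <= 2 `^ p * `|drift_const p| by rewrite ler_peMl.
by rewrite /rosenthal_const; split; lra.
Qed.

Lemma rosenthal_const_gt0 (p : R) : 0 < rosenthal_const p.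
Proof.
have : 0 <= expR 1 * (2 * taylorK p `^ (p / 2)).
  by rewrite !mulr_ge0 ?expR_ge0 ?powR_ge0.
have : 0 <= expR (taylorK p) * taylorK p.
  by rewrite mulr_ge0 ?expR_ge0// (le_trans ler01)// taylorK_ge1.
have := mulr_ge0 (powR_ge0 (2 : R) p) (normr_ge0 (drift_const p)).
by rewrite /rosenthal_const; lra.
Qed.

Section Main.
Variables (n : nat) (X : nat -> T -> R).
Hypothesis n0 : (0 < n)%N.
Hypothesis HX : forall k, (1 <= k <= n)%N -> H (X k).

Let maxE : max_psum X n = (fun w => X 1 w + future_max n 1 (X ^~ w)).
Proof. by apply/funext => w; exact: max_psumE. Qed.

Lemma expect_max_psum (p : R) : 1 <= p -> (forall i, (1 <= i <= n)%N -> Lp p (X i)) ->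
  E (fun w => `|max_psum X n w| `^ p) =
  (Ex (fun w => `|X 1 w + future_max n 1 (X ^~ w)| `^ p))%:E.
Proof.
move=> p1 LpX; rewrite maxE expect_fin//.
by have := Lp_L1 (LpD p1 (LpX 1%N n0) (future_max_Lp p1 LpX n0)).
Qed.

Lemma nonpos_drift (p : R) : 1 <= p -> (forall i, (1 <= i <= n)%N -> Lp p (X i)) ->
  (forall k, (1 <= k <= n)%N -> (E (X k) <= 0)%E) ->
  forall k, (1 <= k <= n)%N -> Ex (X k) <= 0.
Proof.
move=> p1 LpX EX k kn; rewrite -lee_fin -expect_fin ?EX//.
by have := Lp_id p1 (LpX k kn).
Qed.

Lemma rosenthal_neg_dep_le2 (p : R) : 1 <= p <= 2 ->
  (forall k, (1 <= k < n)%N -> neg_dep_to E (single X k) (final X n k)) ->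
  (forall k, (1 <= k <= n)%N -> (E (X k) <= 0)%E) ->
  (E (fun w => `|max_psum X n w| `^ p)%R <=
   (2 `^ (2 - p))%R%:E * \sum_(1 <= k < n.+1) E (fun w => `|X k w| `^ p)%R)%E.
Proof.
move=> /andP[p1 p2] nd EX.
have [->|LpX] := moments_dichotomy p1 HX.
  by rewrite gt0_muley ?leey// lte_fin powR_gt0.
rewrite (expect_max_psum p1 LpX) (sum_expect (f := fun x => `|x| `^ p)).
  rewrite -EFinM lee_fin; apply: moment_bound_le2 => //.
  - exact: nonpos_drift p1 LpX EX.
  - exact: neg_dep_product_rule.
by move=> i ni; exact: (Lp_L1 (LpX i ni)).
Qed.

Lemma rosenthal_neg_dep_ge2 (p : R) : 2 <= p ->
  (forall k, (1 <= k < n)%N -> neg_dep_to E (single X k) (final X n k)) ->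
  (forall k, (1 <= k <= n)%N -> (E (X k) <= 0)%E) ->
  (E (fun w => `|max_psum X n w| `^ p)%R <=
   (rosenthal_const p * n%:R `^ (p / 2 - 1))%R%:E *
     \sum_(1 <= k < n.+1) E (fun w => `|X k w| `^ p)%R)%E.
Proof.
move=> p2 nd EX; have p1 : 1 <= p by lra.
have c0 := rosenthal_const_gt0 p.
have [c1 _ _ _] := rosenthal_const_ge (le_trans ler01 p1).
have [->|LpX] := moments_dichotomy p1 HX.
  by rewrite gt0_muley ?leey// lte_fin mulr_gt0// powR_gt0// ltr0n.
rewrite (expect_max_psum p1 LpX) (sum_expect (f := fun x => `|x| `^ p)).
  rewrite -EFinM lee_fin.
  apply: le_trans (moment_bound_ge2 n0 (nonpos_drift p1 LpX EX) p2 (neg_dep_product_rule nd) LpX) _.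
  by rewrite ler_wpM2r ?(sum_moments_ge0 LpX)// ler_wpM2r ?powR_ge0.
by move=> i ni; exact: (Lp_L1 (LpX i ni)).
Qed.

Lemma rosenthal_indep (p : R) : 2 <= p ->
  (forall k, (1 <= k < n)%N -> indep_to H E (single X k) (final X n k)) ->
  (forall k, (1 <= k <= n)%N -> (E (X k) <= 0)%E) ->
  (E (fun w => `|max_psum X n w| `^ p)%R <=
   (rosenthal_const p)%:E *
     (\sum_(1 <= k < n.+1) E (fun w => `|X k w| `^ p)%R +
      (\sum_(1 <= k < n.+1) E (fun w => `|X k w| ^+ 2)%R) `^ (p / 2)%R))%E.
Proof.
move=> p2 ind EX; have p1 : 1 <= p by lra.
have c0 := rosenthal_const_gt0 p.
have [_ c1 _ _] := rosenthal_const_ge (le_trans ler01 p1).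
have [->|LpX] := moments_dichotomy p1 HX.
  rewrite addye ?gt0_muley ?leey ?lte_fin//.
  by rewrite gt_eqF// (lt_le_trans (ltNyr 0))// poweR_ge0.
rewrite (expect_max_psum p1 LpX) (sum_expect (f := fun x => `|x| `^ p)).
  rewrite (sum_expect_sqr p2 LpX) poweR_EFin -EFinD -EFinM lee_fin.
  apply: le_trans (indep_moment_bound n0 (nonpos_drift p1 LpX EX) p2 ind LpX) _.
  by rewrite ler_wpM2r// addr_ge0 ?powR_ge0// (sum_moments_ge0 LpX).
by move=> i ni; exact: (Lp_L1 (LpX i ni)).
Qed.

Lemma rosenthal_drift (p : R) : 2 <= p ->
  (forall k, (1 <= k < n)%N -> neg_dep_to E (single X k) (final X n k)) \/
  (forall k, (1 <= k < n)%N -> neg_dep_to E (single X k.+1) (initial X k)) ->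
  (E (fun w => max_abs_psum X n w `^ p)%R <=
   (rosenthal_const p)%:E *
     (\sum_(1 <= k < n.+1) E (fun w => `|X k w| `^ p)%R +
      (\sum_(1 <= k < n.+1) E (fun w => `|X k w| ^+ 2)%R) `^ (p / 2)%R +
      (\sum_(1 <= k < n.+1)
         (maxe (- conj_expectation E (X k)) 0 + maxe (E (X k)) 0)) `^ p))%E.
Proof.
move=> p2 nd; have p1 : 1 <= p by lra.
have c0 := rosenthal_const_gt0 p.
have [_ _ c1 c2] := rosenthal_const_ge (le_trans ler01 p1).
have NNy (x : \bar R) (r : R) : (x `^ r != -oo)%E.
  by rewrite gt_eqF// (lt_le_trans (ltNyr 0))// poweR_ge0.
have [->|LpX] := moments_dichotomy p1 HX.
  by rewrite !addye// gt0_muley ?leey ?lte_fin.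
have M0 w := max_abs_psum_ge0 X w n.
have LM := Lp_L1 (max_abs_psum_Lp p1 n0 LpX); rewrite norm_powR_fun// in LM.
rewrite (expect_fin LM) (sum_expect (f := fun x => `|x| `^ p)); last first.
  by move=> i ni; exact: (Lp_L1 (LpX i ni)).
rewrite (sum_expect_sqr p2 LpX).
rewrite sum_drift => [|i ni]; last by have := Lp_id p1 (LpX i ni).
rewrite !poweR_EFin -!EFinD -EFinM lee_fin.
case: nd => nd.
  have ndN k : (1 <= k < n)%N ->
      neg_dep_to E (single (fun i w => - X i w) k) (final (fun i w => - X i w) n k).
    by move=> kn; exact: neg_dep_opp (nd k kn).
  apply: le_trans (max_abs_moment n0 p2 (neg_dep_product_rule nd) (neg_dep_product_rule ndN) LpX) _.
  by rewrite ler_wpM2r ?addr_ge0 ?powR_ge0 ?(sum_moments_ge0 LpX).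
have nd' k : (1 <= k < n)%N -> neg_dep_to E (single (reversed n X) k) (final (reversed n X) n k).
  by move=> kn; apply: neg_dep_reversed => //; apply: nd; lia.
have ndN k : (1 <= k < n)%N ->
    neg_dep_to E (single (fun i w => - reversed n X i w) k) (final (fun i w => - reversed n X i w) n k).
  by move=> kn; exact: neg_dep_opp (nd' k kn).
apply: le_trans (max_abs_moment_reversed n0 p2 (neg_dep_product_rule nd') (neg_dep_product_rule ndN) LpX) _.
by rewrite ler_wpM2r ?addr_ge0 ?powR_ge0 ?(sum_moments_ge0 LpX).
Qed.

End Main.

End SublinearCalculus.

(** * Rosenthal inequalities *)

Theorem theorem2p1 (R : realType) :
  exists C : R -> R, (forall p : R, 0 < C p) /\
  forall (d : measure_display) (T : measurableType d)
    (H : set (T -> R)) (E : (T -> R) -> \bar R)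
    (n : nat) (X : nat -> T -> R),
  sublinear_space H E ->
  (0 < n)%N ->
  (forall k : nat, (1 <= k <= n)%N -> H (X k)) ->
  [/\
    (forall k : nat, (1 <= k < n)%N ->
       neg_dep_to E (single X k) (final X n k)) ->
    (forall k : nat, (1 <= k <= n)%N -> (E (X k) <= 0)%E) ->
    (forall p : R, 1 <= p <= 2 ->
       (E (fun w => `|max_psum X n w| `^ p)%R <=
        (2 `^ (2 - p))%R%:E *
          \sum_(1 <= k < n.+1) E (fun w => `|X k w| `^ p)%R)%E) /\
    (forall p : R, 2 <= p ->
       (E (fun w => `|max_psum X n w| `^ p)%R <=
        (C p * n%:R `^ (p / 2 - 1))%R%:E *
          \sum_(1 <= k < n.+1) E (fun w => `|X k w| `^ p)%R)%E),
    (forall k : nat, (1 <= k < n)%N ->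
       indep_to H E (single X k) (final X n k)) ->
    (forall k : nat, (1 <= k <= n)%N -> (E (X k) <= 0)%E) ->
    forall p : R, 2 <= p ->
       (E (fun w => `|max_psum X n w| `^ p)%R <=
        (C p)%:E *
          (\sum_(1 <= k < n.+1) E (fun w => `|X k w| `^ p)%R +
           (\sum_(1 <= k < n.+1) E (fun w => `|X k w| ^+ 2)%R)
             `^ (p / 2)%R))%E
  & (forall k : nat, (1 <= k < n)%N ->
       neg_dep_to E (single X k) (final X n k)) \/
    (forall k : nat, (1 <= k < n)%N ->
       neg_dep_to E (single X k.+1) (initial X k)) ->
    forall p : R, 2 <= p ->
       (E (fun w => max_abs_psum X n w `^ p)%R <=
        (C p)%:E *
          (\sum_(1 <= k < n.+1) E (fun w => `|X k w| `^ p)%R +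
           (\sum_(1 <= k < n.+1) E (fun w => `|X k w| ^+ 2)%R)
             `^ (p / 2)%R +
           (\sum_(1 <= k < n.+1)
              (maxe (- conj_expectation E (X k)) 0 + maxe (E (X k)) 0))
             `^ p))%E].
Proof.
exists rosenthal_const; split; first exact: rosenthal_const_gt0.
move=> d T H E n X [rvH subE] n0 HX; split.
- move=> nd EX; split=> [p p12|p p2].
    exact: (rosenthal_neg_dep_le2 rvH subE n0 HX p12 nd EX).
  exact: (rosenthal_neg_dep_ge2 rvH subE n0 HX p2 nd EX).
- by move=> ind EX p p2; exact: (rosenthal_indep rvH subE n0 HX p2 ind EX).
- by move=> nd p p2; exact: (rosenthal_drift rvH subE n0 HX p2 nd).
Qed.
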